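(* Let $\mathcal{X}\subset\mathbb{R}^d$ be compact, $k$ a kernel on $\mathcal{X}$, $\sigma>0$, with $k^\sigma(x,y)\le B$ for all $x,y$. Let $f\in\mathcal{H}_k$, $g\in\mathcal{H}_{\sigma^2\delta}$, $h=f+g$. Let $T=NL$ and run Algorithm 4: for $n=1,\dots,N$ choose the batch $X_n=(x_{(n-1)L+1},\dots,x_{nL})$ as a maximizer over $X=(z_1,\dots,z_L)\in\mathcal{X}^L$ of $$\frac1L\sum_{i=1}^L\widehat m_{(n-1)L}(z_i)+\|h\|_{\mathcal{H}_{k^\sigma}}\left(2\sqrt{\frac{\operatorname{tr}(\widehat{\operatorname{cov}}_{n-1}(X,X))}{L}}-\sqrt{\frac{\mathbf{1}^T\widehat{\operatorname{cov}}_{n-1}(X,X)\mathbf{1}}{L^2}}\right),$$ then observe $h$ at all points of $X_n$. Assume maximizers exist and all queried points $x_1,\dots,x_T$ are pairwise distinct. Let $\beta=\max_{n\le N}\|\widehat{\operatorname{cov}}_{n-1}(X_n,X_n)\|_2>0$ and $C_4=\frac{8\beta}{\log(1+\beta\sigma^{-2})}$. Then $$R_T\le\|h\|_{\mathcal{H}_{k^\sigma}}\sqrt{TC_4\gamma_T}+2T\big(\|h\|_{\mathcal{H}_{k^\sigma}}+\|g\|_{\mathcal{H}_{\sigma^2\delta}}\big)\sigma,$$ $$r_T\le\|h\|_{\mathcal{H}_{k^\sigma}}\sqrt{\frac{C_4\gamma_T}{T}}+2\big(\|h\|_{\mathcal{H}_{k^\sigma}}+\|g\|_{\mathcal{H}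_{\sigma^2\delta}}\big)\sigma.$$
   Context: $\delta(x,y)=1$ if $x=y$, else $0$; $k^\sigma=k+\sigma^2\delta$; $\mathcal{H}_{\sigma^2\delta}$ is the RKHS of $\sigma^2\delta$. For query points $x_1,\dots,x_t$ with observations $y_i=h(x_i)$: $\mathbf{k}_t(x)=[k(x,x_i)]_{i\le t}$, $\mathbf{K}_t=[k(x_i,x_j)]_{i,j\le t}$, $\widehat m_t(x)=\mathbf{k}_t(x)^T(\mathbf{K}_t+\sigma^2I)^{-1}\mathbf{y}_t$ ($\widehat m_0\equiv0$). $\overline X_n=\{x_1,\dots,x_{nL}\}$; for an $L$-tuple $X$, $\widehat{\operatorname{cov}}_n(X,X)=\mathbf{K}(X,X)-\mathbf{K}(\overline X_n,X)^T(\sigma^2I+\mathbf{K}(\overline X_n,\overline X_n))^{-1}\mathbf{K}(\overline X_n,X)$, with $\widehat{\operatorname{cov}}_0=\mathbf{K}(X,X)$. $x^*\in\arg\max_{\mathcal{X}}f$; $R_T=\sum_{t=1}^T(f(x^* )-f(x_t))$; $r_T=f(x^* )-\max_{t\le T}f(x_t)$; $\gamma_T=\max_{x_1,\dots,x_T\in\mathcal{X}}\frac12\log\det(\mathbf{I}_T+\sigma^{-2}\mathbf{K}_T)$. *)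

(* Defs.v *)
(* Stdlib reals (needed for sqrt / ln / limits), equipped below with a
   MathComp field structure so that MathComp matrices (det, trace, inverse)
   can be used over Stdlib's R. *)
From HB Require Import structures.
From mathcomp Require Import all_boot all_algebra.
From Stdlib Require Import Reals Lra ClassicalEpsilon FunctionalExtensionality.
Set Implicit Arguments. Unset Strict Implicit. Unset Printing Implicit Defensive.

Definition Req_bool (x y : R) : bool := if Req_EM_T x y then true else false.
Lemma Req_boolP : Equality.axiom Req_bool.
Proof. move=> x y; rewrite /Req_bool; case: Req_EM_T => H; by constructor. Qed.
HB.instance Definition _ := hasDecEq.Build R Req_boolP.

Definition R_find (P : pred R) (n : nat) : option R :=
  match excluded_middle_informative (exists x, P x) with
  | left H => Some (proj1_sig (constructive_indefinite_description _ H))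
  | right _ => None end.
Lemma R_find_correct P n x : R_find P n = Some x -> P x.
Proof. unfold R_find; destruct excluded_middle_informative as [H|H]; last by [].
intros E; injection E as E; rewrite -E;
exact (proj2_sig (constructive_indefinite_description _ H)). Qed.
Lemma R_find_complete (P : pred R) : (exists x, P x) -> exists n, R_find P n.
Proof. move=> H; exists 0%N; rewrite /R_find; by destruct excluded_middle_informative. Qed.
Lemma R_find_ext (P Q : pred R) : P =1 Q -> R_find P =1 R_find Q.
Proof. move=> /functional_extensionality -> //. Qed.
HB.instance Definition _ := hasChoice.Build R R_find_correct R_find_complete R_find_ext.

Lemma R_addA : associative Rplus. Proof. move=> *; ring. Qed.
Lemma R_addC : commutative Rplus. Proof. move=> *; ring. Qed.
Lemma R_add0 : left_id R0 Rplus. Proof. move=> *; ring. Qed.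
Lemma R_addN : left_inverse R0 Ropp Rplus. Proof. move=> *; ring. Qed.
HB.instance Definition _ := GRing.isZmodule.Build R R_addA R_addC R_add0 R_addN.
Lemma R_mulA : associative Rmult. Proof. move=> *; ring. Qed.
Lemma R_mulC : commutative Rmult. Proof. move=> *; ring. Qed.
Lemma R_mul1 : left_id R1 Rmult. Proof. move=> *; ring. Qed.
Lemma R_mulD : left_distributive Rmult Rplus. Proof. move=> *; ring. Qed.
Lemma R_one_neq0 : (R1 : R) != (R0 : R).
Proof. apply/eqP; exact R1_neq_R0. Qed.
HB.instance Definition _ :=
  GRing.Zmodule_isComNzRing.Build R R_mulA R_mulC R_mul1 R_mulD R_one_neq0.
Definition R_inv (x : R) : R := Rinv x.
Lemma R_mulV (x : R) : x != R0 -> Rmult (R_inv x) x = R1.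
Proof. move/eqP=> H; rewrite /R_inv; by field. Qed.
Lemma R_inv0 : R_inv R0 = R0. Proof. exact Rinv_0. Qed.
HB.instance Definition _ := GRing.ComNzRing_isField.Build R R_mulV R_inv0.

(* supremum of a set of reals (0 if it has no least upper bound) *)
Definition Rsup (E : R -> Prop) : R :=
  match excluded_middle_informative (exists m, is_lub E m) with
  | left H => proj1_sig (constructive_indefinite_description _ H)
  | right _ => R0 end.

Definition pt (d : nat) := 'rV[R]_d.

Local Open Scope ring_scope.

Definition enorm (n : nat) (v : 'rV[R]_n) : R := sqrt (\sum_(i < n) v 0 i * v 0 i).
Definition cnorm (n : nat) (v : 'cV[R]_n) : R := sqrt (\sum_(i < n) v i 0 * v i 0).

Definition is_open (d : nat) (U : pt d -> Prop) : Prop :=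
  forall x, U x -> exists eps : R, Rlt R0 eps /\
    forall y, Rlt (enorm (y - x)) eps -> U y.

Definition is_compact (d : nat) (X : pt d -> Prop) : Prop :=
  forall (I : Type) (U : I -> pt d -> Prop),
    (forall i, is_open (U i)) ->
    (forall x, X x -> exists i, U i x) ->
    exists s : list I, forall x, X x -> exists i, List.In i s /\ U i x.

Definition kern (d : nat) := pt d -> pt d -> R.

Definition delta (d : nat) (x y : pt d) : R := if x == y then R1 else R0.

Definition dirac_kernel (d : nat) (sigma : R) : kern d :=
  fun x y => sigma ^+ 2 * delta x y.

Definition ksig (d : nat) (k : kern d) (sigma : R) : kern d :=
  fun x y => k x y + sigma ^+ 2 * delta x y.

Definition is_kernel_on (d : nat) (X : pt d -> Prop) (k : kern d) : Prop :=
  (forall x y, X x -> X y -> k x y = k y x) /\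
  (forall (n : nat) (p : 'I_n -> pt d) (a : 'I_n -> R),
     (forall i, X (p i)) ->
     Rle R0 (\sum_(i < n) \sum_(j < n) a i * a j * k (p i) (p j))).

(* Elements of the pre-Hilbert space H_0 = span{k(., x) : x in X}:
   finite lists of (coefficient, centre). *)
Definition combo (d : nat) := seq (R * pt d).
Definition combo_eval (d : nat) (k : kern d) (c : combo d) (z : pt d) : R :=
  \sum_(q <- c) q.1 * k q.2 z.
Definition combo_norm2 (d : nat) (k : kern d) (c : combo d) : R :=
  \sum_(q <- c) \sum_(q' <- c) q.1 * q'.1 * k q.2 q'.2.
Definition combo_sub (d : nat) (c c' : combo d) : combo d :=
  c ++ map (fun q => (- q.1, q.2)) c'.

(* Standard (Aronszajn / Moore) construction of the RKHS H_k of k on X: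
   h belongs to H_k with norm r iff h is the pointwise limit on X of a
   Cauchy sequence (in the H_0 norm) of elements of H_0, whose H_0 norms
   converge to r. *)
Definition rkhs_norm (d : nat) (X : pt d -> Prop) (k : kern d)
    (h : pt d -> R) (r : R) : Prop :=
  exists c : nat -> combo d,
    (forall n q, List.In q (c n) -> X q.2) /\
    (forall eps : R, Rlt R0 eps -> exists M : nat, forall n m : nat,
        leq M n -> leq M m ->
        Rlt (sqrt (combo_norm2 k (combo_sub (c n) (c m)))) eps) /\
    (forall z, X z -> Un_cv (fun n => combo_eval k (c n) z) (h z)) /\
    Un_cv (fun n => sqrt (combo_norm2 k (c n))) r.

Definition in_rkhs (d : nat) (X : pt d -> Prop) (k : kern d) (h : pt d -> R) :=
  exists r, rkhs_norm X k h r.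

(* (x : nat -> pt d, index 0 unused; observations y_i = h(x_i))        *)
Section Posterior.
Variables (d : nat) (k : kern d) (sigma : R) (x : nat -> pt d) (h : pt d -> R).

Definition Kmat (t : nat) : 'M[R]_t := \matrix_(i < t, j < t) k (x i.+1) (x j.+1).
Definition kvec (t : nat) (z : pt d) : 'cV[R]_t := \col_(i < t) k z (x i.+1).
Definition yvec (t : nat) : 'cV[R]_t := \col_(i < t) h (x i.+1).

Definition mhat (t : nat) (z : pt d) : R :=
  ((kvec t z)^T *m invmx (Kmat t + (sigma ^+ 2)%:M) *m yvec t) 0 0.

Definition covhat (L n : nat) (Z : 'I_L -> pt d) : 'M[R]_L :=
  let KXZ : 'M[R]_(n * L, L) := \matrix_(i < n * L, j < L) k (x i.+1) (Z j) in
  \matrix_(i < L, j < L) k (Z i) (Z j)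
  - KXZ^T *m invmx ((sigma ^+ 2)%:M + Kmat (n * L)) *m KXZ.

(* the acquisition function maximised at round n (uses \hat m_{(n-1)L},
   \hat cov_{n-1} and the RKHS norm hn = ||h||_{H_{k^sigma}}) *)
Definition acq (L : nat) (hn : R) (n : nat) (Z : 'I_L -> pt d) : R :=
  let C := covhat n.-1 Z in
  (1 / L%:R) * (\sum_(i < L) mhat (n.-1 * L) (Z i))
  + hn * (2%:R * sqrt (\tr C / L%:R)
          - sqrt ((\sum_(i < L) \sum_(j < L) C i j) / (L%:R ^+ 2))).

Definition batch (L n : nat) : 'I_L -> pt d := fun i => x (n.-1 * L + i).+1.

End Posterior.
Arguments batch {d} x L n _.

Definition spec_norm (n : nat) (A : 'M[R]_n) : R :=
  Rsup (fun s => exists v : 'cV[R]_n, cnorm v = R1 /\ s = cnorm (A *m v)).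

Definition gammaT (d : nat) (X : pt d -> Prop) (k : kern d) (sigma : R)
    (T : nat) : R :=
  Rsup (fun v => exists p : 'I_T -> pt d, (forall i, X (p i)) /\
        v = (1 / 2%:R) * ln (\det (1%:M + (sigma ^+ 2)^-1 *:
                              \matrix_(i < T, j < T) k (p i) (p j)))).

Definition beta_max (d : nat) (k : kern d) (sigma : R) (x : nat -> pt d)
    (L N : nat) : R :=
  \big[Rmax/R0]_(1 <= n < N.+1)
     spec_norm (covhat k sigma x n.-1 (batch x L n)).

Definition cum_regret (d : nat) (f : pt d -> R) (xstar : pt d)
    (x : nat -> pt d) (T : nat) : R :=
  \sum_(1 <= t < T.+1) (f xstar - f (x t)).
Definition simple_regret (d : nat) (f : pt d -> R) (xstar : pt d)
    (x : nat -> pt d) (T : nat) : R :=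
  f xstar - \big[Rmax/f (x 1%N)]_(1 <= t < T.+1) f (x t).

(* Main.v *)
Require Import Defs.
From HB Require Import structures.
From mathcomp Require Import all_boot all_order all_algebra perm.
From Stdlib Require Import Reals.
From mathcomp Require Import ring lra.
Set Implicit Arguments. Unset Strict Implicit. Unset Printing Implicit Defensive.
Import Order.TTheory GRing.Theory Num.Theory.

(** Pairing a function of the RKHS of a kernel with a finite signed measure costs at most its
    norm times the square root of the quadratic form of the Gram matrix.  Applied to [h], the
    kernel [k + sigma^2 delta] and the measure "batch average minus its kriging weights", this
    bounds the error of the averaged posterior mean by
    [||h|| (sqrt (1^T C 1 / L^2) + sigma)], with [C] the posterior covariance of the batch.
    Comparing the chosen batch with the constant batch at [x*], whose acquisition value is an
    upper confidence bound for [f x*], leaves the regret [2 ||h|| sqrt (tr C / L)] per point, up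
    to the [sigma] terms.  By Cauchy-Schwarz only [sum_n tr C_n] matters.  Schur complements
    factor [det (1 + K / sigma^2)] into the [det (1 + C_n / sigma^2)], and
    [tr C / b * ln (1 + s b) <= ln (det (1 + s C))] when [0 <= C <= b].  The last inequality is
    obtained without diagonalizing [C], by integrating
    [d/ds ln (det (1 + s C)) = tr (C (1 + s C)^-1) >= tr C / (1 + s b)] through finite steps. *)

(** * Positive semidefinite matrices *)

Section PositiveSemidefinite.
Local Open Scope ring_scope.
Variable F : realFieldType.

Definition mxform m n (A : 'M[F]_(m, n)) (u : 'cV_m) (v : 'cV_n) : F :=
  (u^T *m A *m v) 0 0.

Definition psdmx n (A : 'M[F]_n) := A^T = A /\ forall v, 0 <= mxform A v v.

Lemma mxformE m n (A : 'M[F]_(m, n)) u v :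
  mxform A u v = \sum_i \sum_j u i 0 * v j 0 * A i j.
Proof.
rewrite /mxform mxE exchange_big; apply: eq_bigr => j _.
by rewrite mxE mulr_suml; apply: eq_bigr => i _; rewrite mxE; ring.
Qed.

Lemma mxformDl m n (A : 'M[F]_(m, n)) u u' v :
  mxform A (u + u') v = mxform A u v + mxform A u' v.
Proof. by rewrite /mxform linearD /= !mulmxDl mxE. Qed.

Lemma mxformDr m n (A : 'M[F]_(m, n)) u v v' :
  mxform A u (v + v') = mxform A u v + mxform A u v'.
Proof. by rewrite /mxform mulmxDr mxE. Qed.

Lemma mxformZl m n (A : 'M[F]_(m, n)) a u v :
  mxform A (a *: u) v = a * mxform A u v.
Proof. by rewrite /mxform linearZ /= -!scalemxAl mxE. Qed.

Lemma mxformZr m n (A : 'M[F]_(m, n)) a u v :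
  mxform A u (a *: v) = a * mxform A u v.
Proof. by rewrite /mxform -scalemxAr mxE. Qed.

Lemma mxformNl m n (A : 'M[F]_(m, n)) u v : mxform A (- u) v = - mxform A u v.
Proof. by rewrite -scaleN1r mxformZl mulN1r. Qed.

Lemma mxformNr m n (A : 'M[F]_(m, n)) u v : mxform A u (- v) = - mxform A u v.
Proof. by rewrite -scaleN1r mxformZr mulN1r. Qed.

Lemma mxform_addmx m n (A B : 'M[F]_(m, n)) u v :
  mxform (A + B) u v = mxform A u v + mxform B u v.
Proof. by rewrite /mxform mulmxDr mulmxDl mxE. Qed.

Lemma mxform_scalemx m n (A : 'M[F]_(m, n)) a u v :
  mxform (a *: A) u v = a * mxform A u v.
Proof. by rewrite /mxform -scalemxAr -scalemxAl mxE. Qed.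

Lemma mxform_oppmx m n (A : 'M[F]_(m, n)) u v :
  mxform (- A) u v = - mxform A u v.
Proof. by rewrite -scaleN1r mxform_scalemx mulN1r. Qed.

Lemma mxform_mull m n p (A : 'M[F]_(m, n)) (B : 'M_(m, p)) u v :
  mxform A (B *m u) v = mxform (B^T *m A) u v.
Proof. by rewrite /mxform trmx_mul !mulmxA. Qed.

Lemma mxform_mulr m n p (A : 'M[F]_(m, n)) (B : 'M_(n, p)) u v :
  mxform A u (B *m v) = mxform (A *m B) u v.
Proof. by rewrite /mxform !mulmxA. Qed.

Lemma mxform_trmx m n (A : 'M[F]_(m, n)) u v : mxform A^T v u = mxform A u v.
Proof.
by rewrite /mxform -[u^T *m A *m v]trmxK [RHS]mxE !trmx_mul trmxK mulmxA.
Qed.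

Lemma mxform_block m n (A : 'M[F]_m) (B : 'M_(m, n)) (C : 'M_(n, m)) D u v u' v' :
  mxform (block_mx A B C D) (col_mx u v) (col_mx u' v') =
  mxform A u u' + mxform B u v' + mxform C v u' + mxform D v v'.
Proof.
rewrite /mxform tr_col_mx mul_row_block mul_row_col !mulmxDl !mxE; ring.
Qed.

Lemma mxform_delta m n (A : 'M[F]_(m, n)) i j :
  mxform A (delta_mx i 0) (delta_mx j 0) = A i j.
Proof. by rewrite /mxform trmx_delta -rowE -colE !mxE. Qed.

Lemma mxform1 n (v : 'cV[F]_n) : mxform 1%:M v v = \sum_i v i 0 ^+ 2.
Proof. by rewrite /mxform mulmx1 mxE; apply: eq_bigr => i _; rewrite mxE. Qed.

Lemma mxform1_ge0 n (v : 'cV[F]_n) : 0 <= mxform 1%:M v v.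
Proof. by rewrite mxform1; apply: sumr_ge0 => i _; rewrite sqr_ge0. Qed.

Lemma mxform1_eq0 n (v : 'cV[F]_n) : mxform 1%:M v v = 0 -> v = 0.
Proof.
rewrite mxform1 => /eqP; rewrite psumr_eq0 => [/allP v0|i _]; last exact: sqr_ge0.
apply/colP => i; rewrite mxE; apply/eqP; rewrite -sqrf_eq0.
by apply: v0; rewrite mem_index_enum.
Qed.

(** The form is homogeneous in [s] and [t], so that a vanishing [a] or [c] is covered. The points
    [(c, - b)] and [(- b, a)] give the value [a * c - b ^+ 2] times [c] and times [a]. If neither
    coefficient is positive, both vanish, and [(1, - b)] forces [b = 0]. *)
Lemma discriminant_le (a b c : F) :
  (forall s t, 0 <= s ^+ 2 * a + 2 * s * t * b + t ^+ 2 * c) -> b ^+ 2 <= a * c.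
Proof.
move=> H.
have a0 := H 1 0; have c0 := H 0 1; have H1 := H c (- b); have H2 := H (- b) a.
have [a_gt0|a_le0] := ltP 0 a; first by nra.
have [c_gt0|c_le0] := ltP 0 c; first by nra.
by have := H 1 (- b); nra.
Qed.

Lemma psdmx_cauchy n (A : 'M[F]_n) u v :
  psdmx A -> mxform A u v ^+ 2 <= mxform A u u * mxform A v v.
Proof.
move=> [symA A_ge0]; apply: discriminant_le => s t.
have := A_ge0 (s *: u + t *: v).
rewrite !(mxformDl, mxformDr, mxformZl, mxformZr) -(mxform_trmx A v u) symA; nra.
Qed.

Lemma psdmx1 n : psdmx (1%:M : 'M[F]_n).
Proof. by split=> [|v]; [rewrite trmx1 | exact: mxform1_ge0]. Qed.

Lemma psdmx_diag_ge0 n (A : 'M[F]_n) i : psdmx A -> 0 <= A i i.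
Proof. by move=> [_ A_ge0]; rewrite -mxform_delta. Qed.

Lemma psdmx_tr_ge0 n (A : 'M[F]_n) : psdmx A -> 0 <= \tr A.
Proof. by move=> psdA; apply: sumr_ge0 => i _; apply: psdmx_diag_ge0. Qed.

Lemma psdmx_entry_sqr_le n (A : 'M[F]_n) i j :
  psdmx A -> A i j ^+ 2 <= A i i * A j j.
Proof.
by move=> psdA; rewrite -!(mxform_delta A); apply: psdmx_cauchy.
Qed.

Lemma psdmx_scale n (A : 'M[F]_n) a : 0 <= a -> psdmx A -> psdmx (a *: A).
Proof.
move=> a0 [symA A_ge0]; split=> [|v]; first by rewrite linearZ /= symA.
by rewrite mxform_scalemx mulr_ge0.
Qed.

Lemma psdmxD n (A B : 'M[F]_n) : psdmx A -> psdmx B -> psdmx (A + B).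
Proof.
move=> [symA A0] [symB B0]; split=> [|v]; first by rewrite linearD /= symA symB.
by rewrite mxform_addmx addr_ge0.
Qed.

(** By Cauchy-Schwarz and the arithmetic-geometric mean inequality, [A i j] is at most the mean of
    [A i i] and [A j j]. This later compares the two square roots of the acquisition function. *)
Lemma psdmx_sum_le n (A : 'M[F]_n) :
  psdmx A -> \sum_i \sum_j A i j <= n%:R * \tr A.
Proof.
move=> psdA; apply: (@le_trans _ _ (\sum_i \sum_j (A i i + A j j) / 2)).
  apply: ler_sum => i _; apply: ler_sum => j _.
  have := psdmx_entry_sqr_le i j psdA.
  have := psdmx_diag_ge0 i psdA; have := psdmx_diag_ge0 j psdA.
  move: (A i i) (A j j) (A i j) => a b c b0 a0 le_c2.
  rewrite leNgt; apply/negP => lt_c.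
  have : 0 < (c - (a + b) / 2) * (c + (a + b) / 2) by apply: mulr_gt0; lra.
  by have := sqr_ge0 (a - b); nra.
rewrite le_eqVlt; apply/orP; left; apply/eqP.
transitivity (\sum_i (n%:R / 2 * A i i + \tr A / 2)).
  apply: eq_bigr => i _; rewrite -mulr_suml big_split /= sumr_const card_ord.
  by rewrite -/(mxtrace A) -mulr_natl; field.
by rewrite big_split /= sumr_const card_ord -mulr_sumr -/(mxtrace A) -mulr_natl; field.
Qed.

(** A kernel vector [w] satisfies [a |w|^2 + b w^T A w = 0] with both terms nonnegative, hence
    [w = 0]. *)
Lemma psdmx_reg_unit n (A : 'M[F]_n) a b :
  psdmx A -> 0 < a -> 0 <= b -> a%:M + b *: A \in unitmx.
Proof.
move=> [symA A_ge0] a0 b0; rewrite -row_free_unit -kermx_eq0; apply/rowV0P => v.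
move=> /sub_kermxP; rewrite -[v]trmxK; set w := v^T => Hw.
have : mxform (a%:M + b *: A) w w = 0 by rewrite /mxform Hw mul0mx mxE.
rewrite mxform_addmx -scalemx1 !mxform_scalemx => w0.
suff -> : w = 0 by rewrite trmx0.
apply: mxform1_eq0; have := A_ge0 w; have := mxform1_ge0 w; nra.
Qed.

Lemma psdmx_comm_inv n (A : 'M[F]_n) a b :
  psdmx A -> 0 < a -> 0 <= b ->
  A *m invmx (a%:M + b *: A) = invmx (a%:M + b *: A) *m A.
Proof.
move=> psdA a0 b0; have u := psdmx_reg_unit psdA a0 b0.
apply: (can_inj (mulKmx u)); apply: (can_inj (mulmxK u)).
rewrite !mulmxA mulmxV // mul1mx mulmxKV //.
by rewrite mulmxDl mulmxDr mul_scalar_mx mul_mx_scalar -scalemxAl -scalemxAr.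
Qed.

Lemma psdmx_inv_sym n (A : 'M[F]_n) a b :
  psdmx A -> (invmx (a%:M + b *: A))^T = invmx (a%:M + b *: A).
Proof.
by move=> [symA _]; rewrite trmx_inv linearD /= tr_scalar_mx linearZ /= symA.
Qed.

Lemma psdmx_resolvent n (A : 'M[F]_n) a b :
  psdmx A -> 0 < a -> 0 <= b -> psdmx (A *m invmx (a%:M + b *: A)).
Proof.
move=> psdA a0 b0; have [symA A_ge0] := psdA.
have u := psdmx_reg_unit psdA a0 b0; split.
  by rewrite trmx_mul psdmx_inv_sym // symA psdmx_comm_inv.
(* In terms of [w] the form becomes [a w^T A w + b |A w|^2]. *)
move=> v; pose w := invmx (a%:M + b *: A) *m v.
have -> : v = (a%:M + b *: A) *m w by rewrite /w mulKVmx.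
have AA : mxform A (A *m w) w = mxform 1%:M (A *m w) (A *m w).
  by rewrite mxform_mulr mul1mx.
rewrite mxform_mulr mulmxKV // mulmxDl mul_scalar_mx -scalemxAl.
rewrite mxformDl !mxformZl AA; have := mxform1_ge0 (A *m w); have := A_ge0 w; nra.
Qed.

End PositiveSemidefinite.

(** * Schur complements and lower bounds on determinants *)

Section SchurComplement.
Local Open Scope ring_scope.
Variable F : realFieldType.

Section Block.
Variables (m n : nat) (A : 'M[F]_m) (B : 'M[F]_(m, n)) (D : 'M[F]_n) (s : F).
Hypotheses (psdAD : psdmx (block_mx A B B^T D)) (s_gt0 : 0 < s).

(** Shifted by [s%:M], this is the Schur complement of [s%:M + A] in [s%:M + block_mx A B B^T D].
    With [s] the noise variance it is a posterior covariance. *)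
Definition schur : 'M[F]_n := D - B^T *m invmx (s%:M + A) *m B.

Lemma psdmx_ul : psdmx A.
Proof.
have [sym AD_ge0] := psdAD; split.
  by move: sym; rewrite tr_block_mx => /eq_block_mx[].
move=> v; have := AD_ge0 (col_mx v 0); rewrite mxform_block.
by rewrite -(scale0r (0 : 'cV_n)) !(mxformZl, mxformZr) !mul0r !addr0.
Qed.

Lemma psdmx_dr_sym : D^T = D.
Proof. by have [] := psdAD; rewrite tr_block_mx => /eq_block_mx[]. Qed.

Lemma schur_unit : s%:M + A \in unitmx.
Proof. by rewrite -[A]scale1r psdmx_reg_unit //; apply: psdmx_ul. Qed.

(** Here [a] are the kriging weights, and [B *m w = (s%:M + A) *m a] eliminates [B]. The identity
    gives positivity of [schur] and, later, the exact norm of the prediction error. *)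
Lemma mxform_schur w (a := invmx (s%:M + A) *m (B *m w)) :
  mxform (block_mx A B B^T D) (col_mx (- a) w) (col_mx (- a) w)
  = mxform schur w w - s * mxform 1%:M a a.
Proof.
have Baw : mxform B a w = s * mxform 1%:M a a + mxform A a a.
  have Bw : B *m w = (s%:M + A) *m a by rewrite /a mulKVmx // schur_unit.
  rewrite -[B]mul1mx -mxform_mulr Bw mxform_mulr mul1mx mxform_addmx.
  by rewrite -[s%:M]scalemx1 mxform_scalemx.
rewrite mxform_block /schur mxform_addmx mxform_oppmx !(mxformNl, mxformNr).
rewrite -[in X in _ = _ - X - _]mulmxA -mxform_mulr -mulmxA -/a !mxform_trmx Baw; ring.
Qed.

Lemma psdmx_schur : psdmx schur.
Proof.
split=> [|w].
  rewrite /schur linearB /= psdmx_dr_sym !trmx_mul trmxK -[A]scale1r.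
  by rewrite psdmx_inv_sym ?mulmxA //; apply: psdmx_ul.
have [_ /(_ (col_mx (- (invmx (s%:M + A) *m (B *m w))) w))] := psdAD.
rewrite mxform_schur; set a := _ *m _; have := mulr_ge0 (ltW s_gt0) (mxform1_ge0 a); lra.
Qed.

Lemma det_schur :
  \det (s%:M + block_mx A B B^T D) = \det (s%:M + A) * \det (s%:M + schur).
Proof.
(* Block LU factorization with unit lower triangular factor. *)
have -> : s%:M + block_mx A B B^T D =
    block_mx 1%:M 0 (B^T *m invmx (s%:M + A)) 1%:M *m
    block_mx (s%:M + A) B 0 (s%:M + schur).
  rewrite mulmx_block !mul1mx !mul0mx !addr0 mulmxKV ?schur_unit //.
  rewrite scalar_mx_block add_block_mx !add0r /schur.
  by congr (block_mx _ _ _ _); rewrite addrCA [RHS]addrCA addrC addrA subrK.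
by rewrite det_mulmx det_lblock det_ublock !det1 !mul1r.
Qed.

End Block.

(** Induction on the size: splitting off the first row and column factors the determinant as [1 + a]
    times that of the Schur complement, to which the induction hypothesis applies. *)
Lemma det_add1_ge n (M : 'M[F]_n) : psdmx M -> 1 + \tr M <= \det (1%:M + M).
Proof.
elim: n M => [|n IHn] M psdM.
  by rewrite det_mx00 /mxtrace big_ord0 addr0.
pose a : F := M 0 0; pose r : 'rV[F]_n := @ursubmx _ 1 n 1 n M.
pose D : 'M[F]_n := @drsubmx _ 1 n 1 n M.
have defM : M = block_mx a%:M r r^T D :> 'M_(1 + n).
  rewrite -[LHS](@submxK _ 1 n 1 n M); congr (block_mx _ _ _ _).
    by apply/matrixP => i j; rewrite !ord1 !mxE; congr (M _ _); apply: val_inj.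
  by rewrite /r trmx_ursub; have [-> _] := psdM.
have a0 : 0 <= a by apply: psdmx_diag_ge0.
have psdM' : @psdmx F (1 + n) (block_mx a%:M r r^T D) by rewrite -defM.
have := IHn _ (psdmx_schur psdM' ltr01) => IH.
have -> : \det (1%:M + M) = (1 + a) * \det (1%:M + schur a%:M r D 1).
  rewrite -[1 + a]det_scalar1 [(1 + a)%:M]raddfD defM; exact: (det_schur psdM' ltr01).
have -> : \tr M = a + \tr D.
  have <- : \tr (a%:M : 'M_1) = a by rewrite mxtrace_scalar mulr1n.
  rewrite [in LHS]defM; exact: (@mxtrace_block _ 1 n).
(* The complement is [D - r^T r / (1 + a)], and the two-by-two minors of [M] give
   [|r|^2 <= a * \tr D]. *)
have trS : \tr D <= (1 + a) * \tr (schur a%:M r D 1).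
  rewrite /schur linearB /= -raddfD /= invmx_scalar mul_mx_scalar -scalemxAl mxtraceZ.
  have: \tr (r^T *m r) <= a * \tr D.
    rewrite /mxtrace mulr_sumr; apply: ler_sum => i _.
    rewrite mxE big_ord1 mxE -expr2.
    have := psdmx_entry_sqr_le (lshift n (0 : 'I_1)) (rshift 1 i) psdM'.
    by rewrite block_mxEul block_mxEur block_mxEdr [a%:M _ _]mxE mulr1n.
  have a1 : 1 + a != 0 by rewrite gt_eqF // ltr_wpDr.
  by clear defM; rewrite mulrBr mulVKf //; lra.
by clear defM; nra.
Qed.

Lemma psdmx_det_ge1 n (M : 'M[F]_n) : psdmx M -> 1 <= \det (1%:M + M).
Proof.
by move=> psdM; have := det_add1_ge psdM; have := psdmx_tr_ge0 psdM; lra.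
Qed.

(** * Matrices of operator norm at most [b], the bound being squared to avoid square roots *)

Section Spectral.
Variables (n : nat) (C : 'M[F]_n) (b : F).
Hypotheses (psdC : psdmx C) (b_ge0 : 0 <= b).
Hypothesis C_le : forall v, mxform 1%:M (C *m v) (C *m v) <= b ^+ 2 * mxform 1%:M v v.

Lemma mxform_le_norm v : mxform C v v <= b * mxform 1%:M v v.
Proof.
have Cv := psdmx_cauchy v (C *m v) (psdmx1 F n).
rewrite mxform_mulr mul1mx in Cv.
have := C_le v; have [_ /(_ v)] := psdC; have := mxform1_ge0 v.
move: (mxform C v v) (mxform 1%:M v v) (mxform 1%:M (C *m v) _) Cv => p q r Cv q0 p0 rq.
rewrite -(@ler_pXn2r _ 2) ?nnegrE ?mulr_ge0 //; nra.
Qed.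

(** This is [C^2 <= b C]. Cauchy-Schwarz for the form [C] at [v] and [C v], with [mxform_le_norm] at
    [C v], gives [|C v|^4 <= b |C v|^2 v^T C v]; then [|C v|^2] cancels. *)
Lemma mxform_mul_le_norm v : mxform 1%:M (C *m v) (C *m v) <= b * mxform C v v.
Proof.
have := psdmx_cauchy v (C *m v) psdC; have := mxform_le_norm (C *m v).
have [symC /(_ v)] := psdC; have := mxform1_ge0 (C *m v).
have <- : mxform C v (C *m v) = mxform 1%:M (C *m v) (C *m v).
  by rewrite [RHS]mxform_mull symC mulmx1.
move: (mxform C v v) (mxform C v (C *m v)) (mxform C (C *m v) _) => p q r q0 p0 rq qq.
have bp := mulr_ge0 b_ge0 p0; have [q_gt0|] := ltP 0 q; last by lra.
have : q * q <= q * (b * p) by have := ler_wpM2l p0 rq; lra.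
by rewrite ler_pM2l.
Qed.

(** The comparison holds for each diagonal entry, after writing the basis vector as
    [(1 + s C) w]. *)
Lemma tr_resolvent_ge s :
  0 <= s -> \tr C <= (1 + s * b) * \tr (C *m invmx (1%:M + s *: C)).
Proof.
move=> s0; rewrite /mxtrace mulr_sumr; apply: ler_sum => i _.
have u := psdmx_reg_unit psdC ltr01 s0.
rewrite -!(mxform_delta _ i i); set v := delta_mx i 0.
pose w := invmx (1%:M + s *: C) *m v.
have -> : v = (1%:M + s *: C) *m w by rewrite /w mulKVmx.
rewrite [in X in _ <= _ * X]mxform_mulr mulmxKV // mulmxDl mul1mx -scalemxAl.
have symC := proj1 psdC.
rewrite !(mxformDl, mxformDr, mxformZl, mxformZr).
have <- : mxform C w (C *m w) = mxform C (C *m w) w by rewrite -mxform_trmx symC.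
have -> : mxform C w (C *m w) = mxform 1%:M (C *m w) (C *m w).
  by rewrite [RHS]mxform_mull symC mulmx1.
have := mxform_mul_le_norm w; have := mxform_le_norm (C *m w).
(* With [p], [q], [r] the forms of [C], [C^2], [C^3] at [w], the two sides differ by
   [s (b p - q) + s^2 (b q - r)]. *)
move: (mxform C w w) (mxform 1%:M (C *m w) _) (mxform C (C *m w) _) => p q r rq qp.
have : 0 <= s * (b * p - q) by apply: mulr_ge0; lra.
have : 0 <= s * s * (b * q - r) by rewrite !mulr_ge0 //; lra.
lra.
Qed.

(** A finite form of the derivative of [ln det]: [1 + (s + e) C] factors through [1 + s C], and
    [det_add1_ge] bounds the determinant of the other factor by means of the trace of the
    resolvent. *)
Lemma det_step s e : 0 <= s -> 0 <= e ->
  \det (1%:M + s *: C) * (1 + e * (\tr C / (1 + s * b)))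
  <= \det (1%:M + (s + e) *: C).
Proof.
move=> s0 e0; have u := psdmx_reg_unit psdC ltr01 s0.
have psdR := psdmx_resolvent psdC ltr01 s0.
have -> : 1%:M + (s + e) *: C =
    (1%:M + e *: (C *m invmx (1%:M + s *: C))) *m (1%:M + s *: C).
  by rewrite mulmxDl mul1mx -scalemxAl mulmxKV // scalerDl addrA.
rewrite det_mulmx mulrC.
have := det_add1_ge (psdmx_scale e0 psdR); rewrite mxtraceZ.
have := psdmx_det_ge1 (psdmx_scale s0 psdC); have := tr_resolvent_ge s0.
have sb : 0 < 1 + s * b by rewrite ltr_wpDr // mulr_ge0.
rewrite -ler_pdivrMl // [_^-1 * _]mulrC => le_tr det1 det2.
rewrite ler_pM2r; last by lra.
by apply: le_trans det2; rewrite lerD2l ler_wpM2l.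
Qed.

End Spectral.
End SchurComplement.

(** * The ordered field of real numbers *)

Section RealStructure.
Local Open Scope R_scope.

Definition Rleb (x y : R) : bool := if Rle_dec x y then true else false.

Lemma RlebP x y : reflect (x <= y) (Rleb x y).
Proof. by rewrite /Rleb; case: Rle_dec => H; constructor. Qed.

Lemma Rleb0_add x y : Rleb 0 x -> Rleb 0 y -> Rleb 0 (x + y).
Proof. by move=> /RlebP ? /RlebP ?; apply/RlebP; apply: Rplus_le_le_0_compat. Qed.

Lemma Rleb0_mul x y : Rleb 0 x -> Rleb 0 y -> Rleb 0 (x * y).
Proof. by move=> /RlebP ? /RlebP ?; apply/RlebP; apply: Rmult_le_pos. Qed.

Lemma Rleb0_anti x : Rleb 0 x -> Rleb x 0 -> x = 0.
Proof. by move=> /RlebP ? /RlebP ?; apply: Rle_antisym. Qed.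

Lemma Rleb_sub x y : Rleb 0 (y - x) = Rleb x y.
Proof. by apply/RlebP/RlebP => ?; Lra.lra. Qed.

Lemma Rleb0_total x : Rleb 0 x || Rleb x 0.
Proof. by apply/orP; case: (Rle_dec 0 x) => ?; [left|right]; apply/RlebP; Lra.lra. Qed.

Lemma Rleb0_abs x : Rleb 0 x -> Rabs x = x.
Proof. by move=> /RlebP ?; apply: Rabs_pos_eq. Qed.

HB.instance Definition _ := Num.IntegralDomain_isLeReal.Build R
  Rleb0_add Rleb0_mul Rleb0_anti Rleb_sub Rleb0_total Rabs_Ropp Rleb0_abs
  (fun _ _ => erefl).

End RealStructure.

(** * Estimates for the logarithm, and the lower bound on [ln det] *)

Section RealFacts.
Local Open Scope ring_scope.
Implicit Types x y : R.
Local Arguments ln _ : clear scopes.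
Bind Scope ring_scope with R.

Lemma RleP x y : reflect (Rle x y) (x <= y).
Proof. exact: RlebP. Qed.

Lemma RltP x y : reflect (Rlt x y) (x < y).
Proof.
rewrite lt_neqAle; apply: (iffP andP) => [[/eqP ? /RleP ?]|?]; first by Lra.lra.
by split; [apply/eqP; Lra.lra | apply/RleP; Lra.lra].
Qed.

Lemma INR_natr n : INR n = n%:R :> R.
Proof. by elim: n => // n IHn; rewrite S_INR IHn -natr1. Qed.

Lemma ln_le_sub1 x : 0 < x -> ln x <= x - 1.
Proof.
move=> /RltP x0; apply/RleP.
have := exp_ineq1_le (ln x); rewrite exp_ln // => ?.
change (Rle (ln x) (Rminus x (IZR 1))); Lra.lra.
Qed.

Lemma lnM x y : 0 < x -> 0 < y -> ln (x * y) = ln x + ln y.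
Proof. by move=> /RltP x0 /RltP y0; apply: ln_mult. Qed.

Lemma ler_ln x y : 0 < x -> x <= y -> ln x <= ln y.
Proof.
move=> /RltP x0 /RleP [xy|<-]; last exact: lexx.
by apply/RleP/Rlt_le/ln_increasing.
Qed.

Lemma ln1D_le y : 0 <= y -> ln (1 + y) <= y.
Proof. by move=> y0; rewrite (le_trans (ln_le_sub1 _)) //; lra. Qed.

(** Obtained from [ln z <= z - 1] at [z = (1 + y)^-1]. A quadratic error is enough, since [m] steps
    of length [s / m] then lose only a multiple of [1 / m]. *)
Lemma ln1D_ge y : 0 <= y -> y - y ^+ 2 <= ln (1 + y).
Proof.
move=> y0; have y1 : 0 < 1 + y by lra.
have : ln (1 + y) + ln (1 + y)^-1 = 0.
  by rewrite -lnM ?invr_gt0 // mulfV ?gt_eqF //; exact: ln_1.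
have : ln (1 + y)^-1 <= (1 + y)^-1 - 1 by rewrite ln_le_sub1 ?invr_gt0.
have : (1 + y)^-1 <= 1 - y + y ^+ 2.
  by rewrite -[_^-1]mul1r ler_pdivrMr //; have := mulr_ge0 y0 (mulr_ge0 y0 y0); rewrite expr2; lra.
lra.
Qed.

(** Replaces the passage to the limit of ever finer subdivisions. *)
Lemma ler_archi x y c :
  (forall m : nat, leq 1 m -> x <= y + c / m%:R) -> x <= y.
Proof.
move=> H; rewrite leNgt; apply/negP => lt_yx.
have xy0 : 0 < x - y by lra.
have /RltP := xy0 => /(INR_archimed _ c)[m /RltP].
rewrite INR_natr -[Rmult _ _]/(m%:R * (x - y)) => ltm.
have := H m.+1 isT; rewrite -lerBlDl ler_pdivlMr ?ltr0n //.
by rewrite -natr1; lra.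
Qed.

Section LogDet.
Variables (n : nat) (C : 'M[R]_n) (b : R).
Hypotheses (psdC : psdmx C) (b_gt0 : 0 < b).
Hypothesis C_le : forall v, mxform 1%:M (C *m v) (C *m v) <= b ^+ 2 * mxform 1%:M v v.

Lemma ln_det_ge s : 0 <= s ->
  \tr C / b * ln (1 + s * b) <= ln (\det (1%:M + s *: C)).
Proof.
move=> s0; have b0 := ltW b_gt0; have trC := psdmx_tr_ge0 psdC.
apply: (@ler_archi _ _ ((s * \tr C) ^+ 2)) => m m_gt0.
pose e : R := s / m%:R.
have m0 : (0 : R) < m%:R by rewrite ltr0n.
have e0 : 0 <= e by rewrite divr_ge0 // ltW.
(* Each of the [m] steps of length [e] costs at most [(e * \tr C) ^+ 2], in total
   [(s * \tr C) ^+ 2 / m]. *)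
suff: forall j, \tr C / b * ln (1 + j%:R * e * b)
    <= ln (\det (1%:M + (j%:R * e) *: C)) + j%:R * (e * \tr C) ^+ 2.
  move=> /(_ m); have -> : m%:R * e = s by rewrite /e mulrC divfK ?gt_eqF.
  have -> // : m%:R * (e * \tr C) ^+ 2 = (s * \tr C) ^+ 2 / m%:R.
  by rewrite /e !expr2; field; rewrite gt_eqF.
elim=> [|j IHj].
  rewrite !mul0r scale0r !addr0 det1; have -> : ln 1 = 0 by exact: ln_1.
  by rewrite mulr0.
have je0 : 0 <= j%:R * e by rewrite mulr_ge0.
have jb : 0 < 1 + j%:R * e * b by rewrite ltr_wpDr // mulr_ge0.
have jeq : j.+1%:R * e = j%:R * e + e by rewrite -natr1; ring.
rewrite jeq.
pose u := \tr C / (1 + j%:R * e * b).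
have u0 : 0 <= u by rewrite divr_ge0 // ltW.
have ule : u <= \tr C.
  by rewrite ler_pdivrMr // ler_peMr // lerDl mulr_ge0.
have d1 := psdmx_det_ge1 (psdmx_scale je0 psdC).
have eu0 : 0 <= e * u by rewrite mulr_ge0.
have step : ln (\det (1%:M + (j%:R * e) *: C)) + ln (1 + e * u)
    <= ln (\det (1%:M + (j%:R * e + e) *: C)).
  rewrite -lnM; [|lra|lra]; apply: ler_ln; first by rewrite mulr_gt0; lra.
  exact: det_step.
have -> : 1 + (j%:R * e + e) * b =
    (1 + j%:R * e * b) * (1 + e * b / (1 + j%:R * e * b)).
  by field; rewrite gt_eqF.
have eb0 : 0 <= e * b / (1 + j%:R * e * b) by apply: divr_ge0; [apply: mulr_ge0 | apply: ltW].
rewrite lnM //; last by lra.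
(* The increment of the left side is at most [e * u], whereas [det_step] makes [ln det] grow by at
   least [ln (1 + e * u)]. *)
have le_u : \tr C / b * ln (1 + e * b / (1 + j%:R * e * b)) <= e * u.
  have -> : e * u = \tr C / b * (e * b / (1 + j%:R * e * b)).
    by rewrite /u; field; rewrite !gt_eqF.
  by rewrite ler_wpM2l ?divr_ge0 // ln1D_le.
have ge_u := ln1D_ge eu0.
have eu_le : e * u <= e * \tr C by apply: ler_wpM2l.
have : (e * u) ^+ 2 <= (e * \tr C) ^+ 2 by have etrC := le_trans eu0 eu_le; rewrite ler_pXn2r.
rewrite -natr1; lra.
Qed.

End LogDet.
End RealFacts.

(** * Reproducing kernels *)

Section SquareRoot.
Local Open Scope ring_scope.
Local Arguments sqrt _ : clear scopes.
Bind Scope ring_scope with R.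
Implicit Types x y : R.

Lemma sqr_sqrtR x : 0 <= x -> sqrt x ^+ 2 = x.
Proof. by move=> /RleP x0; rewrite expr2; apply: sqrt_sqrt. Qed.

Lemma sqrtR_ge0 x : 0 <= sqrt x.
Proof. by apply/RleP/sqrt_pos. Qed.

Lemma ler_sqrtR x y : x <= y -> sqrt x <= sqrt y.
Proof. by move=> /RleP xy; apply/RleP/sqrt_le_1_alt. Qed.

Lemma sqrtR_sqr x : 0 <= x -> sqrt (x ^+ 2) = x.
Proof. by move=> /RleP x0; apply: sqrt_square. Qed.

Lemma sqrtR_le x y : 0 <= y -> x <= y ^+ 2 -> sqrt x <= y.
Proof. by move=> y0 xy; rewrite -[leRHS]sqrtR_sqr // ler_sqrtR. Qed.

Lemma sqrtRM x y : 0 <= x -> 0 <= y -> sqrt (x * y) = sqrt x * sqrt y.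
Proof. by move=> /RleP x0 /RleP y0; apply: sqrt_mult. Qed.

Lemma norm_le_sqrt2 x a c :
  0 <= a -> 0 <= c -> x ^+ 2 <= a * c -> `|x| <= sqrt a * sqrt c.
Proof.
move=> a0 c0 le_x2; rewrite -sqrtRM // -(@ler_pXn2r _ 2) ?nnegrE ?sqrtR_ge0 //.
by rewrite sqr_sqrtR ?mulr_ge0 // real_normK ?num_real.
Qed.

Lemma Un_cv_const x : Un_cv (fun=> x) x.
Proof. by move=> e e0; exists 0%N => m _; rewrite Rdist_eq. Qed.

Lemma Un_cv_sum n (u : 'I_n -> nat -> R) (l : 'I_n -> R) :
  (forall i, Un_cv (u i) (l i)) -> Un_cv (fun m => \sum_i u i m) (\sum_i l i).
Proof.
elim: n u l => [|n IHn] u l cv_u.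
  by move=> e e0; exists 0%N => m _; rewrite !big_ord0 Rdist_eq.
rewrite big_ord_recl => e e0.
have [M HM] := CV_plus _ _ _ _ (cv_u ord0) (IHn _ _ (fun i => cv_u (lift ord0 i))) e e0.
by exists M => m /HM; rewrite [in X in _ -> X]big_ord_recl.
Qed.

End SquareRoot.

(** * Gram matrices and the norm bound for functions of an RKHS *)

Section KernelMatrix.
Local Open Scope ring_scope.
Local Arguments sqrt _ : clear scopes.
Bind Scope ring_scope with R.
Variable d : nat.
Implicit Types (k : kern d) (X : pt d -> Prop).

Definition kmx k m n (p : 'I_m -> pt d) (q : 'I_n -> pt d) : 'M[R]_(m, n) :=
  \matrix_(i, j) k (p i) (q j).

Definition ptcat m n (p : 'I_m -> pt d) (q : 'I_n -> pt d) (i : 'I_(m + n)) :=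
  match fintype.split i with inl j => p j | inr j => q j end.

Lemma ptcat_lshift m n (p : 'I_m -> pt d) (q : 'I_n -> pt d) i :
  ptcat p q (lshift n i) = p i.
Proof. by rewrite /ptcat (unsplitK (inl i)). Qed.

Lemma ptcat_rshift m n (p : 'I_m -> pt d) (q : 'I_n -> pt d) i :
  ptcat p q (rshift m i) = q i.
Proof. by rewrite /ptcat (unsplitK (inr i)). Qed.

Lemma ptcat_in X m n (p : 'I_m -> pt d) (q : 'I_n -> pt d) :
  (forall i, X (p i)) -> (forall i, X (q i)) -> forall i, X (ptcat p q i).
Proof. by move=> Xp Xq i; rewrite /ptcat; case: fintype.split. Qed.

Lemma kmx_cat k m n (p : 'I_m -> pt d) (q : 'I_n -> pt d) :
  kmx k (ptcat p q) (ptcat p q) =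
  block_mx (kmx k p p) (kmx k p q) (kmx k q p) (kmx k q q).
Proof.
apply/matrixP => i j; rewrite -[i]splitK -[j]splitK.
case: (fintype.split i) (fintype.split j) => i' [j'|j'] /=.
- by rewrite block_mxEul !mxE !ptcat_lshift.
- by rewrite block_mxEur !mxE ptcat_lshift ptcat_rshift.
- by rewrite block_mxEdl !mxE ptcat_lshift ptcat_rshift.
by rewrite block_mxEdr !mxE !ptcat_rshift.
Qed.

Lemma kmx_tr X k m n (p : 'I_m -> pt d) (q : 'I_n -> pt d) :
  is_kernel_on X k -> (forall i, X (p i)) -> (forall i, X (q i)) ->
  (kmx k p q)^T = kmx k q p.
Proof. by move=> [symk _] Xp Xq; apply/matrixP => i j; rewrite !mxE symk. Qed.

Lemma kmx_psd X k n (p : 'I_n -> pt d) :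
  is_kernel_on X k -> (forall i, X (p i)) -> psdmx (kmx k p p).
Proof.
move=> kerk Xp; split=> [|v]; first exact: (kmx_tr kerk Xp Xp).
rewrite mxformE; have /RleP := proj2 kerk n p (fun i => v i 0) Xp.
congr (_ <= _); apply: eq_bigr => i _.
by apply: eq_bigr => j _; rewrite mxE.
Qed.

Lemma kmx_ksig k sigma m n (p : 'I_m -> pt d) (q : 'I_n -> pt d) :
  kmx (ksig k sigma) p q = kmx k p q + sigma ^+ 2 *: kmx (@delta d) p q.
Proof. by apply/matrixP => i j; rewrite !mxE. Qed.

Lemma kmx_dirac sigma m n (p : 'I_m -> pt d) (q : 'I_n -> pt d) :
  kmx (dirac_kernel sigma) p q = sigma ^+ 2 *: kmx (@delta d) p q.
Proof. by apply/matrixP => i j; rewrite !mxE. Qed.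

Lemma delta_kernel X : is_kernel_on X (@delta d).
Proof.
split=> [x y _ _|n p a _]; first by rewrite /delta eq_sym.
apply/RleP; pose s := undup (codom p).
(* The points may repeat; grouping the coefficients by distinct point [y] turns the form into a sum
   of squares. *)
rewrite [leRHS](_ : _ = \sum_(y <- s) (\sum_i a i * (p i == y)%:R) ^+ 2).
  by apply: sumr_ge0 => y _; apply: sqr_ge0.
under [RHS]eq_bigr => y _ do rewrite expr2 mulr_suml.
rewrite [RHS]exchange_big; apply: eq_bigr => i _.
under [RHS]eq_bigr => y _ do rewrite mulr_sumr.
rewrite [RHS]exchange_big; apply: eq_bigr => j _.
have si : p i \in s by rewrite mem_undup codom_f.
rewrite (bigD1_seq (p i)) ?undup_uniq //= big1 => [|y /negPf ney].
  rewrite eqxx addr0 mulr1 mulrA /delta [p j == _]eq_sym.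
  by case: eqP.
by rewrite [p i == y]eq_sym ney mulr0 mul0r.
Qed.

Lemma kmx_kernel X k :
  (forall n (p : 'I_n -> pt d), (forall i, X (p i)) -> psdmx (kmx k p p)) ->
  is_kernel_on X k.
Proof.
move=> psdk; split=> [y z Xy Xz|n p a Xp].
  pose p (i : 'I_2) := if val i == 0%N then y else z.
  have [|/matrixP/(_ (lift ord0 ord0) ord0)] := psdk 2 p.
    by move=> i; rewrite /p; case: ifP.
  by rewrite !mxE.
have [_ /(_ (\col_i a i))] := psdk n p Xp; rewrite mxformE => sum_ge0.
apply/RleP; move: sum_ge0; congr (_ <= _); apply: eq_bigr => i _.
by apply: eq_bigr => j _; rewrite !mxE.
Qed.

Lemma dirac_kernelP X sigma : is_kernel_on X (dirac_kernel sigma : kern d).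
Proof.
apply: kmx_kernel => n p Xp; rewrite kmx_dirac.
by apply: psdmx_scale; [exact: sqr_ge0 | exact: (kmx_psd (delta_kernel X) Xp)].
Qed.

Lemma ksig_kernel X k sigma : is_kernel_on X k -> is_kernel_on X (ksig k sigma).
Proof.
move=> kerk; apply: kmx_kernel => n p Xp; rewrite kmx_ksig -kmx_dirac.
by apply: psdmxD; apply: (kmx_psd _ Xp) => //; apply: dirac_kernelP.
Qed.

Lemma In_tnth (T : Type) (s : seq T) (i : 'I_(size s)) : List.In (tnth (in_tuple s) i) s.
Proof.
case: i => i lti; rewrite (tnth_nth (tnth (in_tuple s) (Ordinal lti))) /=.
move: (tnth _ _) => x0; elim: s i lti => //= y s IHs [|i] lti /=; first by left.
by right; apply: IHs.
Qed.

(** Cauchy-Schwarz for the joint Gram matrix of the centres of [c] and the points [p], at the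
    vectors [(a, 0)] and [(0, v)] with [a] the coefficients of [c]. *)
Lemma combo_cauchy X k (c : combo d) n (p : 'I_n -> pt d) (v : 'cV[R]_n) :
  is_kernel_on X k -> (forall q, List.In q c -> X q.2) -> (forall i, X (p i)) ->
  `|\sum_i v i 0 * combo_eval k c (p i)|
    <= sqrt (combo_norm2 k c) * sqrt (mxform (kmx k p p) v v).
Proof.
move=> kerk Xc Xp.
pose q i := (tnth (in_tuple c) i).2.
pose a : 'cV[R]_(size c) := \col_i (tnth (in_tuple c) i).1.
have Xq i : X (q i) by apply: Xc; apply: In_tnth.
have -> : combo_norm2 k c = mxform (kmx k q q) a a.
  rewrite mxformE /combo_norm2 big_tnth; apply: eq_bigr => i _.
  by rewrite [LHS]big_tnth; apply: eq_bigr => j _; rewrite !mxE.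
have -> : \sum_i v i 0 * combo_eval k c (p i) = mxform (kmx k q p) a v.
  rewrite mxformE exchange_big /=; apply: eq_bigr => j _.
  rewrite /combo_eval [\sum_(_ <- c) _]big_tnth mulr_sumr; apply: eq_bigr => i _.
  by rewrite !mxE; ring.
have psdq := kmx_psd kerk Xq; have psdp := kmx_psd kerk Xp.
apply: norm_le_sqrt2; [exact: (proj2 psdq) | exact: (proj2 psdp) |].
have := psdmx_cauchy (col_mx a 0) (col_mx 0 v) (kmx_psd kerk (ptcat_in Xq Xp)).
rewrite kmx_cat !mxform_block.
by rewrite -(scale0r (0 : 'cV_n)) -(scale0r (0 : 'cV_(size c)))
  !(mxformZl, mxformZr) !mul0r !addr0 !add0r.
Qed.

Lemma rkhs_norm_ge0 X k (h : pt d -> R) r : rkhs_norm X k h r -> 0 <= r.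
Proof.
move=> [c [_ [_ [_ cv_r]]]]; apply/RleP.
by apply: Rle_cv_lim (Un_cv_const 0) cv_r => n; apply: sqrt_pos.
Qed.

(** The bound for finite combinations survives the limit: their values at the points [p] and their
    norms both converge. *)
Lemma rkhs_norm_bound X k (h : pt d -> R) r n (p : 'I_n -> pt d) (v : 'cV[R]_n) :
  is_kernel_on X k -> rkhs_norm X k h r -> (forall i, X (p i)) ->
  `|\sum_i v i 0 * h (p i)| <= r * sqrt (mxform (kmx k p p) v v).
Proof.
move=> kerk [c [Xc [_ [cv_h cv_r]]]] Xp; apply/RleP.
have cv_sum : Un_cv (fun m => \sum_i v i 0 * combo_eval k (c m) (p i))
    (\sum_i v i 0 * h (p i)).
  apply: Un_cv_sum => i; exact: (CV_mult _ _ _ _ (Un_cv_const (v i 0)) (cv_h _ (Xp i))).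
apply: Rle_cv_lim (cv_cvabs _ _ cv_sum) (CV_mult _ _ _ _ cv_r (Un_cv_const _)) => m.
by apply/RleP; apply: (combo_cauchy _ kerk) => // q; apply: Xc.
Qed.

End KernelMatrix.

(** * Spectral norm, finite maxima and information gain *)

Section Suprema.
Local Open Scope ring_scope.
Local Arguments sqrt _ : clear scopes.
Local Arguments ln _ : clear scopes.
Bind Scope ring_scope with R.

(** The upper bound [b] and the element [y] ensure that a least upper bound exists, which excludes
    the default value of [Rsup]. *)
Lemma Rsup_ub (E : R -> Prop) y b :
  (forall z, E z -> z <= b) -> E y -> y <= Rsup E.
Proof.
move=> ubE Ey; rewrite /Rsup.
case: ClassicalEpsilon.excluded_middle_informative => [lubE|[]].
  by case: ClassicalEpsilon.constructive_indefinite_description => m /= [ub _]; apply/RleP/ub.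
have [||m lubm] := completeness E; last by exists m.
- by exists b => z /ubE /RleP.
- by exists y.
Qed.

Lemma cnormE n (v : 'cV[R]_n) : cnorm v = sqrt (mxform 1%:M v v).
Proof. by rewrite /cnorm mxform1; congr sqrt; apply: eq_bigr => i _; rewrite expr2. Qed.

(** The Frobenius bound, by Cauchy-Schwarz in each row. It shows that the set defining [spec_norm]
    is bounded. *)
Lemma mxform1_mulmx_le n (C : 'M[R]_n) v :
  mxform 1%:M (C *m v) (C *m v) <= (\sum_i \sum_j C i j ^+ 2) * mxform 1%:M v v.
Proof.
rewrite [leLHS]mxform1 mulr_suml; apply: ler_sum => i _.
have := psdmx_cauchy (row i C)^T v (psdmx1 _ n).
rewrite [mxform _ (row i C)^T (row i C)^T]mxform1.
under eq_bigr => j _ do rewrite !mxE.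
by rewrite /mxform trmxK mulmx1 -row_mul mxE.
Qed.

Lemma spec_norm_ge n (C : 'M[R]_n) b v : spec_norm C <= b ->
  mxform 1%:M (C *m v) (C *m v) <= b ^+ 2 * mxform 1%:M v v.
Proof.
move=> leCb; have [v0|v_neq0] := eqVneq (mxform 1%:M v v) 0.
  by rewrite v0 mulr0 (mxform1_eq0 v0) mulmx0 /mxform mulmx0 mxE.
have v_gt0 : 0 < mxform 1%:M v v by rewrite lt_neqAle eq_sym v_neq0 mxform1_ge0.
pose r := sqrt (mxform 1%:M v v).
have r2 : r ^+ 2 = mxform 1%:M v v by rewrite sqr_sqrtR // ltW.
have r_gt0 : 0 < r.
  by rewrite lt_neqAle sqrtR_ge0 andbT; apply: contra_neq v_neq0; rewrite -r2 => <-; rewrite expr0n.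
have unit1 : cnorm (r^-1 *: v) = 1.
  rewrite cnormE mxformZl mxformZr -r2 mulrA -expr2 -exprMn mulVf ?gt_eqF // expr1n.
  exact: sqrt_1.
have : cnorm (C *m (r^-1 *: v)) <= b.
  apply: le_trans leCb; pose S := \sum_i \sum_j C i j ^+ 2.
  apply: (@Rsup_ub _ _ (sqrt S)); last by exists (r^-1 *: v).
  move=> z [w [w1 ->]]; rewrite cnormE ler_sqrtR //.
  apply: le_trans (mxform1_mulmx_le _ _) _.
  by rewrite -(sqr_sqrtR (mxform1_ge0 w)) -cnormE w1 -[R1]/(1 : R) expr1n mulr1.
rewrite cnormE -scalemxAr mxformZl mxformZr mulrA -expr2.
set y := _ * _ => le_b.
have y0 : 0 <= y by rewrite mulr_ge0 ?sqr_ge0 ?mxform1_ge0.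
have : sqrt y ^+ 2 <= b ^+ 2.
  by rewrite ler_pXn2r ?nnegrE ?sqrtR_ge0 //; apply: le_trans le_b; apply: sqrtR_ge0.
by rewrite sqr_sqrtR // /y mulrC exprVn ler_pdivrMr ?exprn_gt0 // r2.
Qed.

Lemma bigRmax_ge (r : seq nat) (F : nat -> R) x0 i :
  i \in r -> F i <= \big[Rmax/x0]_(j <- r) F j.
Proof.
elim: r => // j r IHr; rewrite inE big_cons => /predU1P[->|/IHr le_i].
  by apply/RleP/Rmax_l.
by apply: le_trans le_i _; apply/RleP/Rmax_r.
Qed.

Lemma sum_sqrt_le n (a : 'I_n -> R) : (forall i, 0 <= a i) ->
  \sum_i sqrt (a i) <= sqrt (n%:R * \sum_i a i).
Proof.
move=> a0; rewrite -[leLHS]sqrtR_sqr; last by apply: sumr_ge0 => i _; apply: sqrtR_ge0.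
apply: ler_sqrtR.
have := psdmx_cauchy (const_mx 1) (\col_i sqrt (a i)) (psdmx1 R n).
rewrite !mxform1 /mxform mulmx1 mxE.
under eq_bigr => i _ do rewrite !mxE mul1r.
under [X in _ <= X * _ -> _]eq_bigr => i _ do rewrite mxE expr1n.
under [X in _ <= _ * X -> _]eq_bigr => i _ do rewrite mxE sqr_sqrtR //.
by rewrite sumr_const card_ord.
Qed.

(** Leibniz expansion. The crude bound serves only to make the supremum in [gammaT] finite. *)
Lemma det_le_entries n (A : 'M[R]_n) b :
  (forall i j, `|A i j| <= b) -> \det A <= n`!%:R * b ^+ n.
Proof.
move=> leAb; apply: le_trans (ler_norm _) _; apply: le_trans (ler_norm_sum _ _ _) _.
rewrite -card_Sn mulr_natl -sumr_const; apply: ler_sum => s _.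
rewrite normrM normrX normrN1 expr1n mul1r normr_prod.
rewrite -[X in b ^+ X]card_ord -prodr_const; apply: ler_prod => i _.
by rewrite normr_ge0 leAb.
Qed.

Section Gamma.
Variables (d : nat) (X : pt d -> Prop) (k : kern d) (sigma B : R).
Hypotheses (kerk : is_kernel_on X k) (sigma_gt0 : 0 < sigma).
Hypothesis k_le : forall y z, X y -> X z -> ksig k sigma y z <= B.

(** The one-sided hypothesis bounds the diagonal of [k]; Cauchy-Schwarz on two points then bounds
    the other values in absolute value. *)
Lemma kernel_le y z : X y -> X z -> `|k y z| <= B.
Proof.
move=> Xy Xz; pose p := ptcat (fun _ : 'I_1 => y) (fun _ : 'I_1 => z).
have Xp : forall i, X (p i) by apply: ptcat_in.
have psdp := kmx_psd kerk Xp.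
have le_diag u : X u -> k u u <= B.
  move=> Xu; have := k_le Xu Xu; rewrite /ksig /delta eqxx -[R1]/(1 : R) mulr1.
  by have := sqr_ge0 sigma; lra.
have := psdmx_entry_sqr_le (lshift 1 ord0) (rshift 1 ord0) psdp.
have := psdmx_diag_ge0 (lshift 1 ord0) psdp; have := psdmx_diag_ge0 (rshift 1 ord0) psdp.
rewrite !mxE /p !ptcat_lshift !ptcat_rshift; have := le_diag _ Xy; have := le_diag _ Xz.
move: (k y y) (k z z) (k y z) => a c e cB aB c0 a0 e2.
have B0 : 0 <= B by lra.
rewrite -(@ler_pXn2r _ 2) ?nnegrE // real_normK ?num_real //.
by apply: le_trans e2 _; rewrite expr2 ler_pM.
Qed.

Lemma ln_det_le_gammaT T (p : 'I_T -> pt d) : (forall i, X (p i)) ->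
  ln (\det (1%:M + (sigma ^+ 2)^-1 *: kmx k p p)) <= 2 * gammaT X k sigma T.
Proof.
move=> Xp; rewrite -ler_pdivrMl //.
have s0 : 0 <= (sigma ^+ 2)^-1 by rewrite invr_ge0 sqr_ge0.
pose b : R := 1 + (sigma ^+ 2)^-1 * `|B|.
apply: (@Rsup_ub _ _ (1 / 2%:R * ln (T`!%:R * b ^+ T))); last first.
  by exists p; split=> //; congr (_ * _); rewrite mul1r.
move=> _ [q [Xq ->]]; rewrite ler_wpM2l ?divr_ge0 //; apply: ler_ln.
  by apply: lt_le_trans ltr01 _; apply: psdmx_det_ge1; apply: psdmx_scale s0 (kmx_psd kerk Xq).
apply: det_le_entries => i j; rewrite !mxE.
apply: le_trans (ler_normD _ _) _; rewrite lerD //.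
  by case: eqP; rewrite ?normr1 ?normr0.
rewrite normrM ger0_norm // ler_wpM2l //.
by apply: le_trans (kernel_le _ _) (ler_norm _).
Qed.

End Gamma.
End Suprema.

(** * Posterior mean and covariance *)

Section Posterior.
Local Open Scope ring_scope.
Local Arguments sqrt _ : clear scopes.
Local Arguments ln _ : clear scopes.
Bind Scope ring_scope with R.
Variables (d : nat) (X : pt d -> Prop) (k : kern d) (sigma : R).
Variables (x : nat -> pt d).
Hypotheses (kerk : is_kernel_on X k) (sigma_gt0 : 0 < sigma).

Definition query t (i : 'I_t) : pt d := x i.+1.

(** This is [covhat] written as a Schur complement for any number [t] of observations; the two are
    convertible when [t] is [n * L]. *)
Definition postcov t L (Z : 'I_L -> pt d) : 'M[R]_L :=
  schur (Kmat k x t) (kmx k (@query t) Z) (kmx k Z Z) (sigma ^+ 2).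

Lemma noise_gt0 : 0 < sigma ^+ 2. Proof. by rewrite exprn_gt0. Qed.

Section Query.
Variables (t L : nat) (Z : 'I_L -> pt d).
Hypotheses (Xq : forall i : 'I_t, X (query i)) (XZ : forall i, X (Z i)).

Lemma gram_block : kmx k (ptcat (@query t) Z) (ptcat (@query t) Z) =
  block_mx (Kmat k x t) (kmx k (@query t) Z) (kmx k (@query t) Z)^T (kmx k Z Z).
Proof. by rewrite kmx_cat (kmx_tr kerk Xq XZ). Qed.

Lemma psdmx_gram_block : psdmx (block_mx (Kmat k x t) (kmx k (@query t) Z)
  (kmx k (@query t) Z)^T (kmx k Z Z)).
Proof. by rewrite -gram_block; apply: (kmx_psd kerk); apply: ptcat_in. Qed.

Lemma psdmx_postcov : psdmx (postcov t Z).
Proof. exact: (psdmx_schur psdmx_gram_block noise_gt0). Qed.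

Lemma Kmat_psd : psdmx (Kmat k x t).
Proof. exact: (psdmx_ul psdmx_gram_block). Qed.

Section MeanError.
Variables (h : pt d -> R) (hn : R) (w : 'cV[R]_L).
Hypothesis h_norm : rkhs_norm X (ksig k sigma) h hn.
Hypothesis inj_q : injective (@query t).

Let a := invmx ((sigma ^+ 2)%:M + Kmat k x t) *m (kmx k (@query t) Z *m w).

(** Symmetry of the regularized inverse moves it from the observations onto the weights, so that the
    averaged posterior mean is a fixed measure applied to [h]. *)
Lemma mhat_comb : \sum_i w i 0 * mhat k sigma x h t (Z i) = \sum_j a j 0 * h (query j).
Proof.
transitivity ((a^T *m yvec x h t) 0 0); last first.
  by rewrite mxE; apply: eq_bigr => j _; rewrite !mxE.
rewrite /a !trmx_mul -[Kmat k x t]scale1r (psdmx_inv_sym _ _ Kmat_psd) scale1r.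
rewrite -!mulmxA mxE; apply: eq_bigr => i _; rewrite mxE; congr (_ * _).
rewrite /mhat -mulmxA addrC !mxE; apply: eq_bigr => j _; rewrite !mxE.
by rewrite (proj1 kerk _ _ (XZ i) (Xq j)).
Qed.

(* The error is [h] applied to the signed measure with weights [w] on [Z] and [- a] on
   the queries; its squared norm for [k + sigma^2 delta] is computed exactly. *)
Lemma mean_error :
  mxform (kmx (@delta d) Z Z) w w <= 1 ->
  0 <= mxform (kmx (@delta d) (@query t) Z) a w ->
  `|\sum_i w i 0 * (h (Z i) - mhat k sigma x h t (Z i))|
    <= hn * (sqrt (mxform (postcov t Z) w w) + sigma).
Proof.
move=> le1 ge0.
have -> : \sum_i w i 0 * (h (Z i) - mhat k sigma x h t (Z i)) =
    \sum_i (col_mx (- a) w) i 0 * h (ptcat (@query t) Z i).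
  rewrite big_split_ord /=.
  under [X in _ = X + _]eq_bigr => i _ do rewrite col_mxEu mxE ptcat_lshift mulNr.
  under [X in _ = _ + X]eq_bigr => i _ do rewrite col_mxEd ptcat_rshift.
  rewrite sumrN -mhat_comb addrC -sumrB.
  by apply: eq_bigr => i _; rewrite mulrBr.
have := rkhs_norm_bound (col_mx (- a) w)
  (ksig_kernel sigma kerk) h_norm (ptcat_in Xq XZ).
move=> /le_trans; apply; rewrite ler_wpM2l ?(rkhs_norm_ge0 h_norm) //.
have wCw := proj2 psdmx_postcov w.
have s0 := sqrtR_ge0 (mxform (postcov t Z) w w).
apply: sqrtR_le; first by rewrite addr_ge0 // ltW.
rewrite kmx_ksig mxform_addmx mxform_scalemx gram_block.
rewrite (mxform_schur psdmx_gram_block noise_gt0) -/a -/(postcov t Z).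
rewrite kmx_cat mxform_block !(mxformNl, mxformNr).
(* As the queries are distinct, their noise part [sigma^2 |a|^2] cancels the term subtracted by
   [mxform_schur]. The noise on [Z] adds at most [sigma^2], and the cross term only lowers the
   total. *)
have -> : kmx (@delta d) (@query t) (@query t) = 1%:M.
  by apply/matrixP => i j; rewrite !mxE /delta (inj_eq inj_q); case: eqP.
rewrite -(kmx_tr (p := @query t) (delta_kernel (fun=> True))) // mxform_trmx.
have -> : (sqrt (mxform (postcov t Z) w w) + sigma) ^+ 2 = mxform (postcov t Z) w w
    + sigma ^+ 2 + 2 * (sigma * sqrt (mxform (postcov t Z) w w)).
  by rewrite sqrrD sqr_sqrtR //; ring.
rewrite -subr_ge0 in le1; have := mulr_ge0 (ltW noise_gt0) le1.
have := mulr_ge0 (ltW noise_gt0) ge0; have := mulr_ge0 (ltW sigma_gt0) s0; lra.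
Qed.

End MeanError.

(** For distinct new points the noise form of the weights is [1 / L] and the cross term vanishes. *)
Lemma mean_error_fresh h hn :
  rkhs_norm X (ksig k sigma) h hn -> injective (@query t) -> injective Z ->
  (forall (i : 'I_t) j, query i != Z j) -> leq 1 L ->
  `|\sum_i L%:R^-1 * (h (Z i) - mhat k sigma x h t (Z i))|
    <= hn * (sqrt (mxform (postcov t Z) (const_mx L%:R^-1) (const_mx L%:R^-1)) + sigma).
Proof.
move=> h_norm inj_q inj_Z newZ L_gt0.
have := mean_error (w := const_mx L%:R^-1) h_norm inj_q.
under eq_bigr => i _ do rewrite mxE.
apply.
  have -> : kmx (@delta d) Z Z = 1%:M.
    by apply/matrixP => i j; rewrite !mxE /delta (inj_eq inj_Z); case: eqP.
  have L1 : (1 : R) <= L%:R by rewrite ler1n.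
  rewrite mxform1; under eq_bigr => i _ do rewrite mxE.
  rewrite sumr_const card_ord -[leLHS]mulr_natl expr2 mulrA mulfV ?gt_eqF ?(lt_le_trans ltr01) //.
  by rewrite mul1r invf_le1 // (lt_le_trans ltr01).
have -> : kmx (@delta d) (@query t) Z = 0.
  by apply/matrixP => i j; rewrite !mxE /delta (negPf (newZ i j)).
by rewrite /mxform mulmx0 mul0mx mxE.
Qed.

End Query.

(** All weights sit on one point, so their noise form is exactly 1. The point may have been queried
    already, and then the sign of the cross term needs an argument. *)
Lemma mean_error_const t L z h hn (Z := fun _ : 'I_L => z) :
  (forall i : 'I_t, X (query i)) -> X z ->
  rkhs_norm X (ksig k sigma) h hn -> injective (@query t) -> leq 1 L ->
  `|\sum_i L%:R^-1 * (h (Z i) - mhat k sigma x h t (Z i))|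
    <= hn * (sqrt (mxform (postcov t Z) (const_mx L%:R^-1) (const_mx L%:R^-1)) + sigma).
Proof.
move=> Xq Xz h_norm inj_q L_gt0.
have XZ i : X (Z i) by [].
have := mean_error (Z := Z) Xq XZ (w := const_mx L%:R^-1) h_norm inj_q.
under eq_bigr => i _ do rewrite mxE.
apply.
  rewrite mxformE.
  under eq_bigr => i _ do under eq_bigr => j _ do rewrite !mxE /delta eqxx [_ * R1]mulr1.
  rewrite !sumr_const !card_ord -mulrnA -[leLHS]mulr_natl natrM.
  by rewrite mulrACA mulfV ?mulr1 // pnatr_eq0 -lt0n.
have psdK := Kmat_psd Xq XZ.
case: (boolP [exists i : 'I_t, query i == z]) => [/existsP[i /eqP qi]|/existsPn new].
  (* If [z] is a query, its kernel column is a column of the Gram matrix [K]. With [u] as below, the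
     cross term is then the form of [K (sigma^2 + K)^-1] at [u], nonnegative by
     [psdmx_resolvent]. *)
  have KE : kmx k (@query t) Z = Kmat k x t *m kmx (@delta d) (@query t) Z.
    apply/matrixP => j l; rewrite !mxE (bigD1 i) //= big1 => [|i' ne_i'].
      by rewrite !mxE /delta /Z -qi eqxx addr0 [RHS]mulr1.
    by rewrite !mxE /delta /Z -qi (inj_eq inj_q) (negPf ne_i') [LHS]mulr0.
  set E := kmx (@delta d) _ _ in KE *; pose u : 'cV_t := E *m const_mx L%:R^-1.
  have [_ /(_ u)] := psdmx_resolvent psdK noise_gt0 ler01.
  rewrite psdmx_comm_inv // ?noise_gt0 // scale1r KE -mulmxA -/u.
  rewrite -(mxform_trmx (_ *m Kmat k x t)) -[X in mxform X](mulmx1) -mxform_mull.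
  by rewrite -mulmxA -[in X in _ -> X](mul1mx E) -mxform_mulr.
have -> : kmx (@delta d) (@query t) Z = 0.
  by apply/matrixP => i j; rewrite !mxE /delta (negPf (new i)).
by rewrite /mxform mulmx0 mul0mx mxE.
Qed.

End Posterior.

(** * Regret *)

Section Regret.
Local Open Scope ring_scope.
Local Arguments sqrt _ : clear scopes.
Local Arguments ln _ : clear scopes.
Bind Scope ring_scope with R.

Lemma sum_batches N L (F : nat -> R) :
  \sum_(1 <= t < (N * L).+1) F t = \sum_(m < N) \sum_(i < L) F (m * L + i).+1.
Proof.
rewrite big_add1 big_mkord; elim: N => [|N IHN]; first by rewrite mul0n !big_ord0.
by rewrite mulSnr big_split_ord /= IHN big_ord_recr.
Qed.

Variables (d : nat) (X : pt d -> Prop) (k : kern d) (sigma : R).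
Variables (x : nat -> pt d) (L : nat).
Hypotheses (kerk : is_kernel_on X k) (sigma_gt0 : 0 < sigma) (L_gt0 : leq 1 L).

Local Notation cov m := (postcov k sigma x (m * L) (batch x L m.+1)).

Lemma ptcat_query t i :
  ptcat (@query d x t) (fun j : 'I_L => x (t + j).+1) i = query x i.
Proof.
rewrite -[i]splitK; case: (fintype.split i) => j /=.
  by rewrite ptcat_lshift.
by rewrite ptcat_rshift.
Qed.

Lemma det1D_inv n (M : 'M[R]_n) s :
  s != 0 -> \det (1%:M + s^-1 *: M) = s^-1 ^+ n * \det (s%:M + M).
Proof.
by move=> s0; rewrite -detZ scalerDr scale_scalar_mx mulVf.
Qed.

(** Batches count from 0 here: [cov m] is the covariance of the batch that follows the first [m].
    The Schur factorization splits the Gram matrix after [m * L] queries. *)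
Lemma det_batch m : (forall i : 'I_(m * L + L), X (query x i)) ->
  \det (1%:M + (sigma ^+ 2)^-1 *: Kmat k x (m.+1 * L)) =
  \det (1%:M + (sigma ^+ 2)^-1 *: Kmat k x (m * L)) *
  \det (1%:M + (sigma ^+ 2)^-1 *: cov m).
Proof.
move=> Xq; have s_gt0 := noise_gt0 sigma_gt0.
have Xq' (i : 'I_(m * L)) : X (query x i) by have := Xq (lshift L i).
have XZ i : X (batch x L m.+1 i) by have := Xq (rshift (m * L) i).
rewrite mulSnr !det1D_inv ?gt_eqF // mulrACA -exprD; congr (_ * _).
rewrite -(det_schur (psdmx_gram_block kerk Xq' XZ) s_gt0) -(gram_block kerk Xq' XZ).
by congr (\det (_ + _)); apply/matrixP => i j; rewrite !mxE !ptcat_query.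
Qed.

(** Induction on the number of batches: [det_batch] makes the logarithms add up, and [ln_det_ge]
    bounds the contribution of each batch. *)
Lemma tr_cov_sum_le N b : 0 < b -> (forall i : 'I_(N * L), X (query x i)) ->
  (forall m, leq m.+1 N -> spec_norm (cov m) <= b) ->
  (\sum_(m < N) \tr (cov m)) / b * ln (1 + (sigma ^+ 2)^-1 * b)
  <= ln (\det (1%:M + (sigma ^+ 2)^-1 *: Kmat k x (N * L))).
Proof.
move=> b_gt0; have s_ge0 : 0 <= (sigma ^+ 2)^-1 by rewrite invr_ge0 sqr_ge0.
elim: N => [|N IHN] Xq le_b.
  rewrite big_ord0 !mul0r mul0n det_mx00; have -> : ln 1 = 0 by exact: ln_1.
  exact: lexx.
have Xq1 : forall i : 'I_(N * L + L), X (query x i).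
  by move: Xq; rewrite mulSnr.
have Xq' (i : 'I_(N * L)) : X (query x i) by have := Xq1 (lshift L i).
have XZ i : X (batch x L N.+1 i) by have := Xq1 (rshift (N * L) i).
have psdC := psdmx_postcov kerk sigma_gt0 Xq' XZ.
have psdK := Kmat_psd kerk Xq' XZ.
rewrite det_batch // lnM; first last.
- by apply: lt_le_trans ltr01 _; apply: psdmx_det_ge1; apply: psdmx_scale.
- by apply: lt_le_trans ltr01 _; apply: psdmx_det_ge1; apply: psdmx_scale.
rewrite big_ord_recr /= !mulrDl; apply: lerD.
  by apply: IHN => // m ltmN; apply: le_b; apply: leqW.
by apply: ln_det_ge => // v; apply: spec_norm_ge; apply: le_b.
Qed.

Section Batch.
Variables (f g h : pt d -> R) (hn gn : R) (xstar : pt d) (m : nat).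
Hypotheses (g_norm : rkhs_norm X (dirac_kernel sigma) g gn).
Hypotheses (hE : forall z, h z = f z + g z).
Hypothesis (h_norm : rkhs_norm X (ksig k sigma) h hn).
Hypotheses (Xq : forall i : 'I_(m.+1 * L), X (query x i)) (Xstar : X xstar).
Hypothesis (inj_q : injective (@query d x (m.+1 * L))).
Hypothesis batch_max :
  acq k sigma x h hn m.+1 (fun _ : 'I_L => xstar) <= acq k sigma x h hn m.+1 (batch x L m.+1).

(** The norm bound for the unit mass at [z], whose quadratic form is [sigma^2]. *)
Lemma dirac_norm_bound z : X z -> `|g z| <= gn * sigma.
Proof.
move=> Xz; have := @rkhs_norm_bound _ _ _ _ _ 1 (fun=> z) (const_mx 1)
  (dirac_kernelP X sigma) g_norm (fun=> Xz).
rewrite big_ord1 mxE mul1r mxformE !big_ord1 !mxE !mul1r.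
by rewrite /dirac_kernel /delta eqxx [_ * R1]mulr1 sqrtR_sqr // ltW.
Qed.

Lemma acqE (Z : 'I_L -> pt d) : acq k sigma x h hn m.+1 Z =
  \sum_i L%:R^-1 * mhat k sigma x h (m * L) (Z i) +
  hn * (2 * sqrt (\tr (postcov k sigma x (m * L) Z) / L%:R) -
        sqrt (mxform (postcov k sigma x (m * L) Z) (const_mx L%:R^-1) (const_mx L%:R^-1))).
Proof.
transitivity (1 / L%:R * (\sum_i mhat k sigma x h (m * L) (Z i)) +
  hn * (2 * sqrt (\tr (postcov k sigma x (m * L) Z) / L%:R) -
        sqrt ((\sum_i \sum_j postcov k sigma x (m * L) Z i j) / L%:R ^+ 2))).
  by [].
rewrite mul1r mulr_sumr; congr (_ + _ * (_ - sqrt _)).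
rewrite mxformE mulrC mulr_sumr; apply: eq_bigr => i _; rewrite mulr_sumr.
by apply: eq_bigr => j _; rewrite !mxE -exprVn expr2.
Qed.

(** In the acquisition value of the chosen batch, the subtracted square root cancels against the
    error of its averaged mean, leaving twice the trace term. The two mean errors add
    [2 * hn * sigma]; passing from [h] to [f] at both ends adds [2 * gn * sigma]. *)
Lemma batch_regret :
  f xstar - L%:R^-1 * (\sum_i f (batch x L m.+1 i))
  <= 2 * (hn * sqrt (\tr (cov m) / L%:R)) + 2 * ((hn + gn) * sigma).
Proof.
have Xq1 : forall i : 'I_(m * L + L), X (query x i) by move: Xq; rewrite mulSnr.
have inj1 : injective (@query d x (m * L + L)) by move: inj_q; rewrite mulSnr.
have Xq' (i : 'I_(m * L)) : X (query x i) by have := Xq1 (lshift L i).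
have XZ i : X (batch x L m.+1 i) by have := Xq1 (rshift (m * L) i).
have inj' : injective (@query d x (m * L)).
  by move=> i j eqij; apply: (@lshift_inj _ L); apply: inj1.
have injZ : injective (batch x L m.+1).
  by move=> i j eqij; apply: (@rshift_inj (m * L)); apply: inj1.
have newZ (i : 'I_(m * L)) j : query x i != batch x L m.+1 j.
  by apply/eqP => /(inj1 (lshift L i) (rshift (m * L) j)) /eqP; rewrite eq_lrshift.
have L0 : (0 : R) < L%:R by rewrite ltr0n.
have sumL (c : R) : \sum_(i < L) L%:R^-1 * c = c.
  by rewrite sumr_const card_ord -[LHS]mulr_natl mulVKf ?gt_eqF.
have := mean_error_const kerk sigma_gt0 Xq' Xstar h_norm inj' L_gt0.
have := mean_error_fresh kerk sigma_gt0 Xq' XZ h_norm inj' injZ newZ L_gt0.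
move: batch_max; rewrite !acqE.
set w := const_mx _; set S := postcov k sigma x _ (fun=> xstar).
have splitB (u v : 'I_L -> R) : \sum_i L%:R^-1 * (u i - v i) =
    \sum_i L%:R^-1 * u i - \sum_i L%:R^-1 * v i.
  by rewrite -sumrB; apply: eq_bigr => i _; rewrite mulrBr.
rewrite !splitB !sumL.
(* Hence, at the constant batch, twice the trace root minus the other root is at least the latter,
   and the acquisition value plus [hn * sigma] bounds [h xstar]. *)
have le_tr : sqrt (mxform S w w) <= sqrt (\tr S / L%:R).
  apply: ler_sqrtR.
  have := psdmx_sum_le (psdmx_postcov kerk sigma_gt0 Xq' (fun _ : 'I_L => Xstar)).
  rewrite -/S mxformE => le_sum.
  have -> : \sum_i \sum_j w i 0 * w j 0 * S i j = (\sum_i \sum_j S i j) / L%:R / L%:R.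
    rewrite !mulr_suml; apply: eq_bigr => i _; rewrite !mulr_suml.
    by apply: eq_bigr => j _; rewrite !mxE; ring.
  by rewrite ler_pM2r ?invr_gt0 // ler_pdivrMr // mulrC.
have := ler_wpM2l (rkhs_norm_ge0 h_norm) le_tr.
have g_avg : \sum_i L%:R^-1 * g (batch x L m.+1 i) <= gn * sigma.
  rewrite -[leRHS]sumL; apply: ler_sum => i _; rewrite ler_wpM2l ?invr_ge0 ?(ltW L0) //.
  by apply: le_trans (ler_norm _) (dirac_norm_bound _).
have h_avg : \sum_i L%:R^-1 * h (batch x L m.+1 i) =
    L%:R^-1 * (\sum_i f (batch x L m.+1 i)) + \sum_i L%:R^-1 * g (batch x L m.+1 i).
  by rewrite mulr_sumr -big_split; apply: eq_bigr => i _; rewrite hE mulrDr.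
have := dirac_norm_bound Xstar; rewrite h_avg hE !ler_norml.
move=> /andP[? ?] ? ? /andP[? ?] /andP[? ?]; lra.
Qed.

End Batch.
End Regret.

(** * Cumulative and simple regret over all batches *)

Section Algorithm4.
Local Open Scope ring_scope.
Local Arguments sqrt _ : clear scopes.
Local Arguments ln _ : clear scopes.
Bind Scope ring_scope with R.

Lemma ln1D_gt0 (y : R) : 0 < y -> 0 < ln (1 + y).
Proof.
move=> y0; have /RltP lt1 : 1 < 1 + y by rewrite ltrDl.
have /RltP := ln_increasing _ _ Rlt_0_1 lt1; rewrite ln_1; exact.
Qed.

Lemma IZR8 : IZR 8 = 8.
Proof. by rewrite -[RHS]INR_natr INR_IZR_INZ. Qed.

Lemma pow2E (s : R) : pow s 2 = s ^+ 2.
Proof. by rewrite /= Rmult_1_r. Qed.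

Lemma mulr_sqrtR_div (a b : R) : 0 < a -> 0 <= b -> a * sqrt (b / a) = sqrt (a * b).
Proof.
move=> a_gt0 b0; have a0 := ltW a_gt0.
rewrite -{1}[a]sqrtR_sqr // -sqrtRM ?sqr_ge0 ?divr_ge0 //.
by congr sqrt; field; rewrite gt_eqF.
Qed.

Variables (d : nat) (X : pt d -> Prop) (k : kern d) (sigma B : R).
Variables (f g h : pt d -> R) (hn gn : R).
Variables (N L : nat) (x : nat -> pt d) (xstar : pt d).
Hypotheses (kerk : is_kernel_on X k) (sigma_gt0 : 0 < sigma).
Hypothesis k_le : forall y z, X y -> X z -> ksig k sigma y z <= B.
Hypotheses (g_norm : rkhs_norm X (dirac_kernel sigma) g gn).
Hypotheses (hE : forall z, h z = f z + g z).
Hypothesis (h_norm : rkhs_norm X (ksig k sigma) h hn).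
Hypotheses (L_gt0 : leq 1 L) (N_gt0 : leq 1 N).
Hypothesis batch_in : forall m, leq m.+1 N -> forall i, X (batch x L m.+1 i).
Hypothesis batch_max : forall m, leq m.+1 N ->
  forall Z : 'I_L -> pt d, (forall i, X (Z i)) ->
  acq k sigma x h hn m.+1 Z <= acq k sigma x h hn m.+1 (batch x L m.+1).
Hypothesis x_inj : injective (@query d x (N * L)).
Hypothesis Xstar : X xstar.
Let beta := beta_max k sigma x L N.
Hypothesis beta_gt0 : 0 < beta.

Local Notation cov m := (postcov k sigma x (m * L) (batch x L m.+1)).

Lemma query_in (i : 'I_(N * L)) : X (query x i).
Proof.
(* Query [i] is entry [i %% L] of batch [i %/ L], both counted from 0. *)
have := batch_in (m := i %/ L) _ (Ordinal (ltn_pmod i L_gt0)).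
by rewrite ltn_divLR // /batch /= -divn_eq; apply.
Qed.

Lemma batch_le m : leq m.+1 N -> leq (m.+1 * L) (N * L).
Proof. by move=> ltmN; rewrite leq_mul2r ltmN orbT. Qed.

Lemma query_in_batch m (i : 'I_(m.+1 * L)) : leq m.+1 N -> X (query x i).
Proof. by move=> /batch_le leN; have := query_in (widen_ord leN i). Qed.

Lemma query_inj_batch m : leq m.+1 N -> injective (@query d x (m.+1 * L)).
Proof.
move=> /batch_le leN i j eqij; apply: val_inj.
by have [] := @x_inj (widen_ord leN i) (widen_ord leN j) eqij.
Qed.

Lemma psdmx_cov m : leq m.+1 N -> psdmx (cov m).
Proof.
move=> ltmN; apply: (psdmx_postcov kerk) => // [i|]; last exact: batch_in.
have le_m : leq (m * L) (m.+1 * L) by rewrite leq_mul2r leqnSn orbT.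
by have := query_in_batch (widen_ord le_m i) ltmN.
Qed.

Lemma tr_cov_sum_ge0 : 0 <= \sum_(m < N) \tr (cov m).
Proof. by apply: sumr_ge0 => m _; apply: psdmx_tr_ge0; apply: psdmx_cov. Qed.

(** The factor 4 is the square of the factor 2 in [batch_regret]; a further 2 comes from the one
    half in [gammaT]. *)
Lemma tr_cov_sum_le_gammaT :
  4 * \sum_(m < N) \tr (cov m)
  <= 8 * beta / ln (1 + beta / sigma ^+ 2) * gammaT X k sigma (N * L).
Proof.
have ln_gt0 : 0 < ln (1 + beta / sigma ^+ 2).
  by apply: ln1D_gt0; rewrite divr_gt0 ?exprn_gt0.
have := ln_det_le_gammaT kerk k_le query_in.
move: (tr_cov_sum_le kerk sigma_gt0 (b := beta) beta_gt0 query_in) => tr_le gam_ge.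
have {tr_le gam_ge} := le_trans (tr_le _) gam_ge; rewrite [_^-1 * beta]mulrC => tr_le.
have {}tr_le : (\sum_(m < N) \tr (cov m)) / beta * ln (1 + beta / sigma ^+ 2)
    <= 2 * gammaT X k sigma (N * L).
  apply: tr_le => m ltmN;
  apply: (@bigRmax_ge _ (fun n => spec_norm (covhat k sigma x n.-1 (batch x L n))) _ m.+1).
  by rewrite mem_index_iota.
rewrite -ler_pdivlMr // ler_pdivrMr // in tr_le.
have -> : 8 * beta / ln (1 + beta / sigma ^+ 2) * gammaT X k sigma (N * L)
  = 4 * (2 * gammaT X k sigma (N * L) / ln (1 + beta / sigma ^+ 2) * beta).
  by field; rewrite gt_eqF.
by rewrite ler_pM2l.
Qed.

Lemma cum_regret_le :
  cum_regret f xstar x (N * L)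
  <= hn * sqrt ((N * L)%:R * (8 * beta / ln (1 + beta / sigma ^+ 2))
       * gammaT X k sigma (N * L)) + 2 * (N * L)%:R * (hn + gn) * sigma.
Proof.
have L0 : (0 : R) < L%:R by rewrite ltr0n.
rewrite /cum_regret sum_batches.
apply: (@le_trans _ _ (\sum_(m < N) (2 * hn * sqrt (L%:R * \tr (cov m))
   + L%:R * (2 * ((hn + gn) * sigma))))).
  apply: ler_sum => m _.
  have := batch_regret kerk sigma_gt0 L_gt0 g_norm hE h_norm
    (fun i => query_in_batch i (ltn_ord m)) Xstar (query_inj_batch (ltn_ord m))
    (batch_max (ltn_ord m) (fun=> Xstar)).
  move=> /(ler_wpM2l (ltW L0)) le_m.
  rewrite sumrB sumr_const card_ord -[f xstar *+ _]mulr_natl.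
  rewrite mulrBr mulVKf ?gt_eqF // mulrDr in le_m; apply: le_trans le_m _.
  rewrite -(mulr_sqrtR_div L0) ?(psdmx_tr_ge0 (psdmx_cov (ltn_ord m))) //.
  by rewrite lerD2r; lra.
rewrite big_split /= -mulr_sumr sumr_const card_ord natrM lerD //; last first.
  by rewrite -mulr_natl; lra.
rewrite -mulrA mulrCA; apply: ler_wpM2l; first exact: rkhs_norm_ge0 h_norm.
have tr0 := tr_cov_sum_ge0.
(* Cauchy-Schwarz over the [N] batches; the factor 2 then enters the root as 4. *)
apply: (@le_trans _ _ (2 * sqrt (N%:R * \sum_(m < N) L%:R * \tr (cov m)))).
  rewrite ler_pM2l //; apply: sum_sqrt_le => m; apply: mulr_ge0; first exact: ltW.
  by apply: psdmx_tr_ge0; apply: psdmx_cov.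
have -> : 2 * sqrt (N%:R * \sum_(m < N) L%:R * \tr (cov m))
    = sqrt (4 * (N%:R * L%:R * \sum_(m < N) \tr (cov m))).
  rewrite -mulr_sumr mulrA [RHS]sqrtRM ?mulr_ge0 //; congr (_ * _).
  by rewrite (_ : 4 = 2 ^+ 2 :> R) ?sqrtR_sqr //; ring.
apply: ler_sqrtR; rewrite mulrCA -mulrA ler_wpM2l ?mulr_ge0 //.
exact: tr_cov_sum_le_gammaT.
Qed.

(** The best value found dominates every [f (x t)], so each summand of the cumulative regret is at
    least the simple regret. *)
Lemma simple_regret_le_cum :
  (N * L)%:R * simple_regret f xstar x (N * L) <= cum_regret f xstar x (N * L).
Proof.
rewrite (_ : (N * L)%:R = \sum_(1 <= t < (N * L).+1) (1 : R)); last first.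
  by rewrite sumr_const_nat subSS subn0.
rewrite /cum_regret /simple_regret mulr_suml [leLHS]big_seq [leRHS]big_seq.
apply: ler_sum => t t_in; rewrite mul1r lerD2l lerN2.
by apply: (@bigRmax_ge _ (fun t => f (x t))).
Qed.

Lemma simple_regret_le :
  simple_regret f xstar x (N * L)
  <= hn * sqrt (8 * beta / ln (1 + beta / sigma ^+ 2)
       * gammaT X k sigma (N * L) / (N * L)%:R) + 2 * (hn + gn) * sigma.
Proof.
have T0 : (0 : R) < (N * L)%:R by rewrite ltr0n muln_gt0 N_gt0.
rewrite -(ler_pM2l T0); apply: le_trans simple_regret_le_cum _.
apply: le_trans cum_regret_le _.
rewrite [leRHS]mulrDr [_ * (hn * sqrt (_ / _))]mulrCA (mulr_sqrtR_div T0).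
  by rewrite [_ * (_ * gammaT _ _ _ _)]mulrA lerD2l; lra.
(* Moving the factor [N * L] into the root needs a nonnegative radicand, which holds because it
   dominates a sum of traces. *)
by apply: le_trans tr_cov_sum_le_gammaT; rewrite mulr_ge0 // tr_cov_sum_ge0.
Qed.

End Algorithm4.
Open Scope R_scope.

Theorem theorem6
  (d : nat) (X : pt d -> Prop) (k : kern d) (sigma B : R)
  (f g h : pt d -> R) (hn gn : R)
  (N L T : nat) (x : nat -> pt d) (xstar : pt d) :
  is_compact X ->
  is_kernel_on X k ->
  0 < sigma ->
  (forall y z, X y -> X z -> ksig k sigma y z <= B) ->
  in_rkhs X k f ->
  rkhs_norm X (dirac_kernel sigma) g gn ->
  (forall z, h z = f z + g z) ->
  rkhs_norm X (ksig k sigma) h hn ->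
  leq 1 L -> leq 1 N ->
  T = muln N L ->
  (* Algorithm 4: each batch X_n lies in X^L and maximises the acquisition *)
  (forall n, leq 1 n -> leq n N ->
     (forall i, X (batch x L n i)) /\
     (forall Z : 'I_L -> pt d, (forall i, X (Z i)) ->
        acq k sigma x h hn n Z <= acq k sigma x h hn n (batch x L n))) ->
  (* queried points pairwise distinct *)
  (forall i j, leq 1 i -> leq i T -> leq 1 j -> leq j T -> i <> j -> x i <> x j) ->
  (* x* is a maximiser of f over X *)
  X xstar -> (forall z, X z -> f z <= f xstar) ->
  0 < beta_max k sigma x L N ->
  let beta := beta_max k sigma x L N in
  let C4 := 8 * beta / ln (1 + beta / sigma ^ 2) in
  let gam := gammaT X k sigma T in
  cum_regret f xstar x T
    <= hn * sqrt (INR T * C4 * gam) + 2 * INR T * (hn + gn) * sigma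
  /\
  simple_regret f xstar x T
    <= hn * sqrt (C4 * gam / INR T) + 2 * (hn + gn) * sigma.
Proof.
move=> _ kerk /RltP sigma_gt0 k_le' _ g_norm hE h_norm L_gt0 N_gt0 -> batchP x_neq.
move=> Xstar _ /RltP beta_gt0 beta C4 gam.
have k_le y z : X y -> X z -> is_true (Order.le (ksig k sigma y z) B).
  by move=> Xy Xz; apply/RleP; apply: k_le'.
have batch_in m : leq m.+1 N -> forall i, X (batch x L m.+1 i).
  by move=> ltmN; have [] := batchP m.+1 isT ltmN.
have batch_max m : leq m.+1 N ->
    forall Z : 'I_L -> pt d, (forall i, X (Z i)) ->
    is_true (Order.le (acq k sigma x h hn m.+1 Z) (acq k sigma x h hn m.+1 (batch x L m.+1))).
  by move=> ltmN Z XZ; apply/RleP; have [_] := batchP m.+1 isT ltmN; apply.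
(* Ordinals start at 0 and the queried points at 1, hence the successors. *)
have x_inj : injective (@query d x (N * L)).
  move=> i j eqij; apply: val_inj; case: (eqVneq (val i) (val j)) => // /eqP neq_ij.
  by case: (x_neq i.+1 j.+1 isT (ltn_ord i) isT (ltn_ord j) _ eqij) => -[].
rewrite /C4 IZR8 pow2E INR_natr; split; apply/RleP.
  exact: (cum_regret_le kerk sigma_gt0 k_le g_norm hE h_norm).
exact: (simple_regret_le kerk sigma_gt0 k_le g_norm hE h_norm).
Qed.
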